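(* Let $G$ be a connected loopless graph with $p$ vertices, equipped with a standard ordering $e_1<\dots<e_q$ with respect to which $G$ has an NBC basis, and let $C_1,\dots,C_k$ be its fundamental circuits. Then for all $d\ge 0$, $$h_d(G)\le \Big|L_d\big(x_1^{|C_1|-2}x_2^{|C_2|-2}\cdots x_k^{|C_k|-2}\big)\Big| =: l_d(G),$$ and $$\alpha(G)\le \sum_{d=0}^{p-1} l_d(G)\,2^{p-d-1}.$$
   Context: Graphs are finite, possibly with multiple edges. For $G$ with $p$ vertices and $q$ edges put $k=q-p+1$. An ordering $e_1<\dots<e_q$ of $E(G)$ is standard if $G$ is connected and $e_{k+1},\dots,e_q$ form a spanning tree $T$. The fundamental circuits are $C_i$, $1\le i\le k$, the edge set of the unique cycle of $T+e_i$. Work over $\mathbb{Z}_2$ with variable $x_i$ for $e_i$; $\mathbf{x}^S=\prod_{e_i\in S}x_i$. A circuit is the edge set of a cycle; its broken circuit is $\bar C=C\setminus\{\min C\}$. For $j>k$, $D_j$ is the set of edges with one endpoint in each component of $T-e_j$, $\theta_j=\sum_{e_i\in D_j}x_i$. $I(G)$ is the ideal generated by all $\mathbf{x}^{\bar C}$, $R(G)=\mathbb{Z}_2[x_1,\dots,x_q]/(I(G)+\langle\theta_j:j>k\rangle)$. Let $d_j=j$ for $j\le k$, $d_j=\min\{i:e_i\in D_j\}$ for $j>k$; $m_{\bar C}=x_i^{|\bar C_i|}$ if $C=C_i$ ($i\le k$), else $m_{\bar C}=\prod_{e_j\in\bar C}x_{d_j}$. $\mathrm{Mon}(k)$ is the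 set of monomials in $x_1,\dots,x_k$, $U(G)$ those divisible by some $m_{\bar C}$, $L(G)=\mathrm{Mon}(k)\setminus U(G)$; $G$ has an NBC basis with respect to the ordering if the images in $R(G)$ of the monomials in $L(G)$ are distinct and form a $\mathbb{Z}_2$-basis of $R(G)$. For a set $S$ of monomials, $L(S)$ is the set of monomials dividing some element of $S$, and $L_d(S)$ the set of those of total degree $d$. The numbers $h_0(G),\dots,h_p(G)$ are defined by $P(G;\lambda)=\sum_{i=0}^{p-1}(-1)^i h_i(G)\lambda(\lambda-1)^{p-1-i}+(-1)^p h_p(G)$, where $P(G;\lambda)$ is the chromatic polynomial, and $h_d(G)=0$ for $d>p$ (equivalently, $(h_i)$ is the $h$-vector of the broken circuit complex). $\alpha(G)$ is the number of acyclic orientations of $G$. *)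

(* Defs.v *)
From HB Require Import structures.
From mathcomp Require Import all_boot all_order all_algebra.
From mathcomp Require Import generic_quotient ring_quotient.
From mathcomp.multinomials Require Import mpoly.
From mathcomp Require boolp.

Set Implicit Arguments.
Unset Strict Implicit.
Unset Printing Implicit Defensive.

Import GRing.Theory.

Local Open Scope ring_scope.

(* [ends e] has one element exactly when e is a loop. *)
Record multigraph := Multigraph {
  vertex : finType;
  edge : finType;
  ends : edge -> {set vertex};
  ends_card : forall e, (0 < #|ends e| <= 2)%N
}.

Section Graph.

Variable G : multigraph.

Definition nvertices : nat := #|vertex G|.
Definition nedges : nat := #|edge G|.

(* For connected G this is q - p + 1, without truncation. *)
Definition nullity : nat := (nedges.+1 - nvertices)%N.

Definition loopless : Prop := forall e : edge G, #|ends e| = 2.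

Definition adj (S : {set edge G}) : rel (vertex G) :=
  [rel u v | [exists e in S, ends e == [set u; v]]].

Definition spans_connected (S : {set edge G}) : Prop :=
  (0 < nvertices)%N /\ forall u v, connect (adj S) u v.

Definition connected_graph : Prop := spans_connected [set: edge G].

(* Edge sets of cycles v_0 e_0 v_1 e_1 ... v_(n-1) e_(n-1) v_0 with n >= 1
   distinct vertices and n distinct edges (a loop for n = 1, two parallel edges
   for n = 2).  Bounding n by #|V| loses nothing, as the vertices are
   distinct. *)
Definition circuit (C : {set edge G}) : bool :=
  [exists n : 'I_(nvertices.+1), (0 < n)%N &&
    [exists v : {ffun 'I_n -> vertex G}, exists e : {ffun 'I_n -> edge G},
      [&& injectiveb v, injectiveb e,
          [forall i, ends (e i) == [set v i; v (ordS i)]]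
        & C == [set e i | i : 'I_n]]]].

Definition spanning_tree (T : {set edge G}) : Prop :=
  spans_connected T /\ forall C, circuit C -> ~~ (C \subset T).

Definition proper_coloring (n : nat) (f : {ffun vertex G -> 'I_n}) : bool :=
  [forall e : edge G, forall u, forall v,
    (ends e == [set u; v]) ==> (f u != f v)].

Definition is_chromatic_poly (P : {poly int}) : Prop :=
  forall n : nat, P.[n%:Z] = #|[set f | @proper_coloring n f]|%:Z.

(* This determines h: the polynomials X (X - 1)^(p-1-i), i < p, together with 1
   form a basis of the polynomials of degree at most p. *)
Definition is_h_vector (P : {poly int}) (h : nat -> int) : Prop :=
  P = \sum_(i < nvertices)
        ((-1) ^+ i * h i) *: ('X * ('X - 1) ^+ (nvertices - 1 - i))
      + ((-1) ^+ nvertices * h nvertices)%:P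
  /\ forall d, (nvertices < d)%N -> h d = 0.

(* An orientation sends each edge to the pair (tail, head). *)
Definition orientation (w : {ffun edge G -> vertex G * vertex G}) : bool :=
  [forall e, ends e == [set (w e).1; (w e).2]].

Definition arc (w : {ffun edge G -> vertex G * vertex G}) : rel (vertex G) :=
  [rel u v | [exists e, w e == (u, v)]].

(* No arc can be completed to a directed cycle by a directed path from its head
   back to its tail. *)
Definition acyclic (w : {ffun edge G -> vertex G * vertex G}) : bool :=
  [forall e, ~~ connect (arc w) (w e).2 (w e).1].

Definition num_acyclic_orientations : nat :=
  #|[set w | orientation w && acyclic w]|.

(* An ordering of the edges is the enumeration o 0 < o 1 < ... < o (q - 1): the
   edge e_i and the variable x_i have index i - 1. *)
Definition enumeration := 'I_nedges -> edge G.

Variable o : enumeration.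

Definition tree_edges : {set edge G} :=
  [set o j | j : 'I_nedges & (nullity <= j)%N].

Definition standard_ordering : Prop :=
  [/\ bijective o, connected_graph & spanning_tree tree_edges].

Definition min_index (S : {set edge G}) : option 'I_nedges :=
  [pick i | (o i \in S) && [forall j, (o j \in S) ==> (i <= j)%N]].

Definition broken (C : {set edge G}) : {set edge G} :=
  if min_index C is Some i then C :\ o i else C.

(* The default set0 is not reached for i < k under a standard ordering. *)
Definition fund_circuit (i : 'I_nedges) : {set edge G} :=
  odflt set0 [pick C | circuit C && (C \subset o i |: tree_edges)].

Definition fund_cut (j : 'I_nedges) : {set edge G} :=
  [set f | [forall w, exists u in ends f,
             connect (adj (tree_edges :\ o j)) w u]].

Definition xset (S : {set edge G}) : {mpoly 'F_2[nedges]} :=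
  \prod_(i | o i \in S) 'X_i.

Definition theta (j : 'I_nedges) : {mpoly 'F_2[nedges]} :=
  \sum_(i | o i \in fund_cut j) 'X_i.

Definition in_relations (f : {mpoly 'F_2[nedges]}) : Prop :=
  exists (a : {set edge G} -> {mpoly 'F_2[nedges]})
         (b : 'I_nedges -> {mpoly 'F_2[nedges]}),
    f = \sum_(C | circuit C) a C * xset (broken C)
        + \sum_(j < nedges | (nullity <= j)%N) b j * theta j.

Definition relations : pred {mpoly 'F_2[nedges]} :=
  fun f => boolp.asbool (in_relations f).

Lemma relationsP f : reflect (in_relations f) (f \in relations).
Proof. exact: boolp.asboolP. Qed.

Lemma relations_ideal a f : f \in relations -> a * f \in relations.
Proof.
move=> /relationsP[b [c ->]]; apply/relationsP.
exists (fun C => a * b C), (fun j => a * c j).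
rewrite mulrDr !mulr_sumr; congr (_ + _);
  by apply: eq_bigr => ? _; rewrite mulrA.
Qed.

Lemma relations_zmod_closed : zmod_closed relations.
Proof.
split=> [|f g /relationsP[a [b ->]] /relationsP[a' [b' ->]]]; apply/relationsP.
  exists (fun=> 0), (fun=> 0).
  by rewrite !big1 ?addr0 // => ? _; rewrite mul0r.
exists (fun C => a C - a' C), (fun j => b j - b' j).
rewrite opprD addrACA -!sumrB; congr (_ + _);
  by apply: eq_bigr => ? _; rewrite mulrBl.
Qed.

HB.instance Definition _ :=
  GRing.isZmodClosed.Build _ relations relations_zmod_closed.

Definition relations_zmodClosed : zmodClosed {mpoly 'F_2[nedges]} :=
  GRing.ZmodClosed.clone _ relations _.

(* R(G), with its structure of Z_2-module; as R(G) is the zero ring for graphs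
   with loops, it has no general nzRingType structure. *)
Definition nbc_ring : Type :=
  {ideal_quot relations_zmodClosed}.

HB.instance Definition _ := GRing.Zmodule.on nbc_ring.

Definition nbc_class (f : {mpoly 'F_2[nedges]}) : nbc_ring :=
  \pi_({ideal_quot relations_zmodClosed})%qT f.

Lemma nbc_classP f g : nbc_class f = nbc_class g <-> f - g \in relations.
Proof.
rewrite Quotient.idealrBE; split=> [e|/eqP //].
by apply/eqP.
Qed.

Definition nbc_scale (c : 'F_2) (r : nbc_ring) : nbc_ring :=
  nbc_class (c *: (repr r : {mpoly 'F_2[nedges]})).

Lemma nbc_scaleE c f : nbc_scale c (nbc_class f) = nbc_class (c *: f).
Proof.
apply/nbc_classP; rewrite -scalerBr -mul_mpolyC; apply: relations_ideal.
by rewrite Quotient.idealrBE reprK.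
Qed.

Lemma nbc_classD f g : nbc_class (f + g) = nbc_class f + nbc_class g.
Proof. exact: raddfD. Qed.

Lemma nbc_class_surj r : exists f, r = nbc_class f.
Proof. by exists (repr r); rewrite /nbc_class reprK. Qed.

Lemma nbc_scaleA a b v : nbc_scale a (nbc_scale b v) = nbc_scale (a * b) v.
Proof. by have [f ->] := nbc_class_surj v; rewrite !nbc_scaleE scalerA. Qed.

Lemma nbc_scale1 : left_id 1 nbc_scale.
Proof. by move=> v; have [f ->] := nbc_class_surj v; rewrite nbc_scaleE scale1r. Qed.

Lemma nbc_scaleDr : right_distributive nbc_scale +%R.
Proof.
move=> a u v; have [f ->] := nbc_class_surj u; have [g ->] := nbc_class_surj v.
by rewrite -nbc_classD !nbc_scaleE scalerDr nbc_classD.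
Qed.

Lemma nbc_scaleDl v : {morph nbc_scale^~ v : a b / a + b}.
Proof.
move=> a b; have [f ->] := nbc_class_surj v.
by rewrite !nbc_scaleE scalerDl nbc_classD.
Qed.

HB.instance Definition _ := GRing.Zmodule_isLmodule.Build 'F_2 nbc_ring
  nbc_scaleA nbc_scale1 nbc_scaleDr nbc_scaleDl.

Definition dindex (j : 'I_nedges) : 'I_nedges :=
  if (j < nullity)%N then j else odflt j (min_index (fund_cut j)).

Definition mbroken (C : {set edge G}) : 'X_{1..nedges} :=
  if [pick i : 'I_nedges | (i < nullity)%N && (C == fund_circuit i)] is Some i
  then (U_(i) *+ #|broken C|)%MM
  else (\sum_(j | o j \in broken C) U_(dindex j))%MM.

Definition Mon : pred 'X_{1..nedges} :=
  fun m => [forall i : 'I_nedges, (nullity <= i)%N ==> (m i == 0%N)].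

Definition Uset : pred 'X_{1..nedges} :=
  fun m => Mon m && [exists C, circuit C && (mbroken C <= m)%MM].

Definition Lset : pred 'X_{1..nedges} := fun m => Mon m && ~~ Uset m.

Definition fund_monomial : 'X_{1..nedges} :=
  (\sum_(i < nedges | (i < nullity)%N) U_(i) *+ (#|fund_circuit i| - 2))%MM.

End Graph.

(* The family (v i), i in P, is a basis of V; no finiteness is assumed. *)
Definition is_basis (F : fieldType) (V : lmodType F) (I : eqType) (P : pred I)
    (v : I -> V) : Prop :=
  (forall (s : seq I) (c : I -> F), uniq s -> all P s ->
     \sum_(i <- s) c i *: v i = 0 -> {in s, forall i, c i = 0})
  /\ (forall w : V, exists (s : seq I) (c : I -> F),
     all P s /\ w = \sum_(i <- s) c i *: v i).

Definition has_NBC_basis (G : multigraph) (o : enumeration G) : Prop :=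
  {in Lset o &, injective (fun m => nbc_class o 'X_[m])}
  /\ is_basis (Lset o) (fun m => nbc_class o 'X_[m]).

(* The monomials of degree d dividing some element of S. *)
Definition L_deg (n d : nat) (S : seq 'X_{1..n}) : {set 'X_{1..n < d.+1}} :=
  [set m : 'X_{1..n < d.+1} | (mdeg m == d) && has (fun s => (m <= s)%MM) S].

Definition l_num (G : multigraph) (o : enumeration G) (d : nat) : nat :=
  #|L_deg d [:: fund_monomial o]|.

(* Main.v *)
Require Import Defs.
From HB Require Import structures.
From mathcomp Require Import all_boot all_order all_algebra.
From mathcomp Require Import zify ring.
From mathcomp.multinomials Require Import mpoly.

(** By hypothesis the monomials in [L(G)] span [R(G)], and those of degree [d]
    divide the fundamental monomial, so it is enough to show
    [h_d <= dim R(G)_d] and [alpha(G) <= \sum_d h_d 2^(p-1-d)].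

    Delete or contract the edges one by one, from the largest to the smallest.
    If [I] is the broken circuit ideal of a minor and [e] its last edge, neither
    a loop nor a bridge, then [I : x_e] and [I + (x_e)] are the broken circuit
    ideals of the contraction and of the deletion of [e]; if [e] is a bridge, no
    generator of [I] involves [x_e].  At the end of the process the ideal is
    the whole ring or is generated by the variables outside a connected spanning
    subgraph, modulo which the fundamental cuts are independent linear forms.
    Going back, the [theta_j] form a regular sequence modulo every [I], hence
    taking the quotient by them commutes with colon by [x_e] and the dimensions
    of the Artinian quotients add up along deletion and contraction, exactly as
    the [h]-vector read off the chromatic polynomial does.  The number of
    acyclic orientations is bounded by the same recursion. *)

Set Implicit Arguments.
Unset Strict Implicit.
Unset Printing Implicit Defensive.

Import GRing.Theory.

(** * Colorings and acyclic orientations of minors *)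

Lemma connect_ind (T : finType) (r : rel T) (Q : T -> Prop) x y :
  Q x -> (forall u v, Q u -> r u v -> Q v) -> connect r x y -> Q y.
Proof.
move=> Qx Qr /connectP[p + ->]; elim: p x Qx => //= z p IHp x Qx /andP[rxz].
exact/IHp/(Qr x).
Qed.

Lemma connect_img (T : finType) (r r' : rel T) (rho : T -> T) x y :
  (forall u v, r' u v -> connect r (rho u) (rho v)) ->
  connect r' x y -> connect r (rho x) (rho y).
Proof.
move=> rr'; apply: (@connect_ind _ _ (fun z => connect r (rho x) (rho z))) => //.
by move=> u v xu /rr'; apply: connect_trans.
Qed.

Section Minors.

(* The edge [e] joins [s e] to [t e]; contracted edges form a set [A], remaining
   ones a set [B], and an orientation of [B] is encoded by the set [X] of the
   edges directed from [s e] to [t e]. *)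
Variables (V E : finType) (s t : E -> V).
Implicit Types (A B K X : {set E}) (U : {set V}) (e : E) (n : nat).

Definition link A : rel V := [rel u v | [exists e in A,
  (u == s e) && (v == t e) || (u == t e) && (v == s e)]].

Definition conn A : bool := [forall u, forall v, connect (link A) u v].

Definition cut_free A U : Prop := {in A, forall e, (s e \in U) = (t e \in U)}.

Lemma linkP A u v : reflect
  (exists2 e, e \in A & (u, v) = (s e, t e) \/ (u, v) = (t e, s e)) (link A u v).
Proof.
apply: (iffP exists_inP) => -[e eA uv]; exists e => //; last first.
  by case: uv => -[-> ->]; rewrite !eqxx ?orbT.
by case/orP: uv => /andP[/eqP-> /eqP->]; [left|right].
Qed.

Lemma link_edge A e : e \in A -> link A (s e) (t e).
Proof. by move=> eA; apply/linkP; exists e; [|left]. Qed.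

Lemma link_sym A : ssrbool.symmetric (link A).
Proof.
suff sym u v : link A u v -> link A v u by move=> u v; apply/idP/idP; apply: sym.
by case/linkP=> e eA [] [-> ->]; apply/linkP; exists e => //; [right|left].
Qed.

Lemma connect_linkC A u v : connect (link A) u v = connect (link A) v u.
Proof. exact/sym_connect_sym/link_sym. Qed.

Lemma link_sub A K u v : A \subset K -> link A u v -> link K u v.
Proof.
by move=> AK /linkP[e eA uv]; apply/linkP; exists e; [apply: (subsetP AK)|].
Qed.

Lemma connect_link_sub A K u v :
  A \subset K -> connect (link A) u v -> connect (link K) u v.
Proof.
by move=> AK; apply: connect_sub => x y /(link_sub AK)/connect1.
Qed.

Lemma connP A : reflect (forall u v, connect (link A) u v) (conn A).
Proof. by apply: (iffP forallP) => cA u; apply/forallP/cA. Qed.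

Lemma connect_edges A K : {in A, forall e, connect (link K) (s e) (t e)} ->
  forall u v, connect (link A) u v -> connect (link K) u v.
Proof.
move=> AK u v; apply: connect_sub => x y /linkP[e /AK eK [] [-> ->]] //.
by rewrite connect_linkC.
Qed.

(** [U] is the component of [s e] once [e] is removed. If it contained [t e], every passage through
    [e] could be rerouted. *)
Lemma bridge_cut K e : conn K -> ~~ conn (K :\ e) ->
  exists U, [/\ cut_free (K :\ e) U, s e \in U & t e \notin U].
Proof.
move=> /connP cK ncKe; exists [set v | connect (link (K :\ e)) (s e) v]; split.
- move=> f fK; rewrite !inE; have /connect1 st := link_edge fK.
  apply/idP/idP => /connect_trans; apply => //.
  by rewrite connect_linkC.
- by rewrite inE.
rewrite inE; apply: contra ncKe => e_st; apply/connP => u v.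
apply: (connect_edges _ (cK u v)) => f fK; have [->//|ne_fe] := eqVneq f e.
by apply/connect1/link_edge; rewrite !inE ne_fe.
Qed.

Definition colorings n A B : {set {ffun V -> 'I_n}} :=
  [set f : {ffun V -> 'I_n} | [forall e in A, f (s e) == f (t e)]
                            & [forall e in B, f (s e) != f (t e)]].

Definition num_col n A B : nat := #|colorings n A B|.

Lemma coloringsP n A B (f : {ffun V -> 'I_n}) : reflect
  ({in A, forall e, f (s e) = f (t e)} /\ {in B, forall e, f (s e) != f (t e)})
  (f \in colorings n A B).
Proof.
rewrite inE; apply: (iffP andP) => -[cA cB]; split.
- by move=> e eA; apply/eqP; have /forall_inP := cA; apply.
- exact/forall_inP.
- by apply/forall_inP => e /cA ->.
- exact/forall_inP.
Qed.

(** Colorings are sorted by whether the ends of [e] get distinct or equal colors. *)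
Lemma col_delete_contract n A B e :
  num_col n A B = (num_col n A (e |: B) + num_col n (e |: A) B)%N.
Proof.
pose eq_e := [set f : {ffun V -> 'I_n} | f (s e) == f (t e)].
rewrite /num_col -(cardsID eq_e (colorings n A B)) addnC.
congr (_ + _)%N; apply: eq_card => f.
  rewrite !inE /=; apply/andP/andP => [[ne /andP[cA /forall_inP cB]]|[cA /forall_inP cB]].
    split=> //; apply/forall_inP => e'; rewrite !inE => /predU1P[->|/cB] //.
  split; first by apply: cB; rewrite !inE eqxx.
  by rewrite cA; apply/forall_inP => e' e'B; apply: cB; rewrite !inE e'B orbT.
rewrite !inE /=; apply/andP/andP => [[/andP[/forall_inP cA cB] eq]|[/forall_inP cA cB]].
  by split=> //; apply/forall_inP => e'; rewrite !inE => /predU1P[->|/cA].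
split; last by apply: cA; rewrite !inE eqxx.
by rewrite cB andbT; apply/forall_inP => e' e'A; apply: cA; rewrite !inE e'A orbT.
Qed.

Lemma colorings_const n A B f u v : f \in colorings n A B ->
  connect (link A) u v -> f u = f v.
Proof.
case/coloringsP => cA _; apply: (@connect_ind _ _ (fun v => f u = f v)) => //.
by move=> x y -> /linkP[e /cA eq [] [-> ->]].
Qed.

Lemma col_loop n A B e : e \in B -> connect (link A) (s e) (t e) -> num_col n A B = 0%N.
Proof.
move=> eB e_st; apply/eqP; rewrite cards_eq0 -subset0; apply/subsetP => f fAB.
have /coloringsP[_ /(_ e eB)] := fAB.
by rewrite (colorings_const fAB e_st) eqxx.
Qed.

Lemma col_set0 n : num_col n set0 set0 = (n ^ #|V|)%N.
Proof.
rewrite -[in RHS](card_ord n) -card_ffun; apply: eq_card => f; rewrite inE.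
by apply/andP; split; apply/forall_inP => e; rewrite inE.
Qed.

Lemma col_ge n A (v : V) : (n <= num_col n A set0)%N.
Proof.
have cst_inj : injective (fun c : 'I_n => [ffun _ : V => c]).
  by move=> c c' /ffunP/(_ v); rewrite !ffunE.
rewrite -[X in (X <= _)%N](card_ord n) -(card_imset _ cst_inj).
apply: subset_leq_card; apply/subsetP => _ /imsetP[c _ ->].
by apply/coloringsP; split=> e; rewrite ?inE // !ffunE.
Qed.

Lemma col_conn n A (v : V) : conn A -> num_col n A set0 = n.
Proof.
move=> /connP cA; apply/eqP; rewrite eqn_leq col_ge // andbT.
rewrite -[X in (_ <= X)%N](card_ord n).
have eval_inj : {in colorings n A set0 &,
    injective (fun f : {ffun V -> 'I_n} => f v)}.
  move=> f g fA gA fg; apply/ffunP => u.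
  by rewrite (colorings_const fA (cA u v)) (colorings_const gA (cA u v)).
by rewrite /num_col -(card_in_imset eval_inj) max_card.
Qed.

(** Adding a constant to the colors on [U] preserves all the constraints, since nothing in [A] or
    [B] crosses the cut. Each coloring arises by exactly one such shift from exactly one coloring
    with equal colors at the ends of [e]. *)
Lemma col_cut n A B U e : cut_free (A :|: B) U -> s e \in U -> t e \notin U ->
  num_col n A B = (n * num_col n (e |: A) B)%N.
Proof.
case: n => [|n] cutU sU tU.
  apply/eqP; rewrite cards_eq0 -subset0; apply/subsetP => f _.
  by case: (f (s e)).
(* Colors are added modulo [n.+1]; ['I_0] carries no such addition, hence the separate case
   above. *)
pose shift (x : 'I_n.+1 * {ffun V -> 'I_n.+1}) : {ffun V -> 'I_n.+1} :=
  [ffun v => (x.2 v + (if v \in U then x.1 else 0))%R].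
have shift_eq x e' : e' \in A :|: B ->
    (shift x (s e') == shift x (t e')) = (x.2 (s e') == x.2 (t e')).
  by move=> /cutU eqU; rewrite !ffunE eqU (inj_eq (addIr _)).
rewrite -[X in (X * _)%N](card_ord n.+1) -cardsT -cardsX /num_col.
have shift_inj : {in setX [set: 'I_n.+1] (colorings n.+1 (e |: A) B) &,
    injective shift}.
  move=> [c f] [c' f']; rewrite !inE /=.
  move=> /andP[/forall_inP fA _] /andP[/forall_inP fA' _].
  move=> /ffunP eq_sh.
  have tE : f (t e) = f' (t e).
    by have := eq_sh (t e); rewrite !ffunE /= (negPf tU) !addr0.
  have sE : f (s e) = f' (s e).
    by rewrite (eqP (fA e _)) ?(eqP (fA' e _)) ?inE ?eqxx.
  have cE : c = c'.
    by have := eq_sh (s e); rewrite !ffunE /= sU sE => /addrI.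
  congr (_, _) => //; apply/ffunP => v; have := eq_sh v; rewrite !ffunE /= cE.
  exact: addIr.
rewrite -(card_in_imset shift_inj).
apply: eq_card => f; apply/idP/imsetP => [fAB|[[c g]]]; last first.
  rewrite !inE /= => /andP[/forall_inP gA /forall_inP gB] ->.
  apply/andP; split; apply/forall_inP => e' e'AB; rewrite shift_eq ?inE ?e'AB ?orbT //=.
    by apply: gA; rewrite !inE e'AB orbT.
  exact: gB.
(* The shift by [- c] makes the colors at the ends of [e] agree. *)
pose c := (f (s e) - f (t e))%R; pose g := shift (- c, f)%R.
have shift_g : shift (c, g) = f.
  by apply/ffunP => v; rewrite !ffunE /=; case: ifP => _; rewrite ?subrK ?addr0.
exists (c, g); last by rewrite shift_g.
rewrite !inE /=; move: fAB; rewrite inE => /andP[/forall_inP fA /forall_inP fB].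
apply/andP; split; apply/forall_inP => e'; last first.
  by move=> e'B; rewrite shift_eq ?inE ?e'B ?orbT //; apply: fB.
rewrite !inE => /predU1P[->|e'A]; last by rewrite shift_eq ?inE ?e'A //; apply: fA.
by rewrite !ffunE sU (negPf tU) addr0 /c /= opprB addrCA subrr addr0.
Qed.

(** * Acyclic orientations of minors *)

Definition oriented X e : V * V := if e \in X then (s e, t e) else (t e, s e).

(** Contracted edges may be walked both ways, so these walks lift the directed walks of the
    contraction without forming a quotient graph. *)
Definition step A B X : rel V :=
  [rel u v | link A u v || [exists e in B, oriented X e == (u, v)]].

Definition acyc A B X : bool :=
  [forall e in B, ~~ connect (step A B X) (oriented X e).2 (oriented X e).1].

Definition acyclics A B : {set {set E}} := [set X : {set E} | X \subset B & acyc A B X].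

Definition nao A B : nat := #|acyclics A B|.

Lemma stepP A B X u v : reflect
  (link A u v \/ exists2 e, e \in B & oriented X e = (u, v)) (step A B X u v).
Proof.
apply: (iffP orP) => -[luv|]; try by left.
  by move=> /exists_inP[e eB /eqP uv]; right; exists e.
by move=> [e eB uv]; right; apply/exists_inP; exists e => //; apply/eqP.
Qed.

Lemma connect_step_link A B X u v :
  connect (link A) u v -> connect (step A B X) u v.
Proof. by apply: connect_sub => x y xy; apply/connect1/stepP; left. Qed.

Lemma step_oriented A B X e : e \in B -> step A B X (oriented X e).1 (oriented X e).2.
Proof. by move=> eB; apply/stepP; right; exists e => //; apply: surjective_pairing. Qed.

Lemma connect_step_sub A A' B B' X X' u v : A \subset A' -> B \subset B' ->
  {in B, X =i X'} -> connect (step A B X) u v -> connect (step A' B' X') u v.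
Proof.
move=> AA' BB' XX'; apply: connect_sub => x y /stepP[lxy|[e eB exy]].
  by apply/connect1/stepP; left; apply: link_sub lxy.
apply/connect1/stepP; right; exists e; first exact: (subsetP BB').
by rewrite -exy /oriented XX'.
Qed.

Lemma nao_loop A B e : e \in B -> connect (link A) (s e) (t e) -> nao A B = 0%N.
Proof.
move=> eB e_st; apply/eqP; rewrite cards_eq0 -subset0; apply/subsetP => X.
rewrite inE => /andP[_ /forall_inP/(_ e eB)/negP[]].
apply: connect_step_link; rewrite /oriented.
by case: ifP; rewrite //= connect_linkC.
Qed.

Lemma nao_set0 A : nao A set0 <= 1.
Proof.
rewrite -(cards1 (set0 : {set E})); apply: subset_leq_card; apply/subsetP => X.
by rewrite !inE subset0 => /andP[].
Qed.

(** A directed walk of the contraction from the head to the tail of [b] folds onto the side of the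
    cut containing [b]: [rho] collapses the other side to the end of [e] on the side of [b], so
    steps along [e] become trivial. *)
Lemma nao_cut A B U e : cut_free (A :|: B) U -> s e \in U -> t e \notin U ->
  nao A B <= nao (e |: A) B.
Proof.
move=> cutU sU tU; apply: subset_leq_card; apply/subsetP => X.
rewrite !inE => /andP[-> /forall_inP acX] /=; apply/forall_inP => b bB.
apply: contra (acX b bB); set h := (oriented X b).2; set k := (oriented X b).1.
pose end_ c := if c then s e else t e.
have end_U c : (end_ c \in U) = c by case: c; rewrite //= (negPf tU).
pose rho x := if (x \in U) == (h \in U) then x else end_ (h \in U).
have rho_id x : (x \in U) = (h \in U) -> rho x = x by rewrite /rho => ->; rewrite eqxx.
have sameU x y : link A x y \/ (exists2 f, f \in B & oriented X f = (x, y)) ->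
    (x \in U) = (y \in U).
  case=> [/linkP[f fA]|[f fB]]; last rewrite /oriented.
    by have := cutU f; rewrite inE fA => /(_ isT) eqU [] [-> ->].
  by have := cutU f; rewrite inE fB orbT => /(_ isT) eqU; case: ifP => _ [<- <-].
have hk : (k \in U) = (h \in U).
  by apply: sameU; right; exists b => //; apply: surjective_pairing.
rewrite -{2}(rho_id h) // -{2}(rho_id k) //; apply: connect_img => x y /stepP xy.
have [xyA|] : (link A x y \/ exists2 f, f \in B & oriented X f = (x, y)) \/
              (x, y) = (s e, t e) \/ (x, y) = (t e, s e).
  case: xy => [/linkP[f + xy]|]; last by left; right.
  rewrite !inE => /predU1P[fe|fA]; first by right; rewrite -fe.
  by left; left; apply/linkP; exists f.
- rewrite /rho (sameU _ _ xyA); case: ifP => // _; apply/connect1/stepP.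
  by case: xyA; [left|right].
- rewrite /rho; case=> -[-> ->]; rewrite sU (negPf tU) /end_;
  by case: (h \in U).
Qed.

(** Acyclicity for both directions of [e] excludes directed paths between its ends either way. A
    closed walk of the contraction through [b] that uses [e] would yield such a path, or a closed
    walk avoiding [e]. *)
Lemma acyclic_both A B X e : e \notin B -> X \subset B ->
  acyc A (e |: B) X -> acyc A (e |: B) (e |: X) -> acyc (e |: A) B X.
Proof.
move=> eB XB; have eX : e \notin X by apply: contra eB; apply: (subsetP XB).
move=> /forall_inP acX /forall_inP acX1.
pose r := step A B X.
have no_st : ~~ connect r (s e) (t e).
  have := acX e (setU11 _ _); rewrite /oriented (negPf eX) /=; apply: contra.
  by apply: connect_step_sub => //; apply: subsetUr.
have no_ts : ~~ connect r (t e) (s e).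
  have := acX1 e (setU11 _ _); rewrite /oriented setU11 /=; apply: contra.
  apply: connect_step_sub => //; first exact: subsetUr.
  by move=> f fB; rewrite !inE; case: eqP fB eB => // -> ->.
apply/forall_inP => b bB; set h := (oriented X b).2; set k := (oriented X b).1.
have rkh : connect r k h by apply/connect1/step_oriented.
have no_hk : ~~ connect r h k.
  have := acX b; rewrite !inE bB orbT => /(_ isT); apply: contra.
  by apply: connect_step_sub => //; apply: subsetUr.
(* Of a walk that uses [e], only the first end [a] of [e] reached and the last end [c] left are
   remembered. *)
pose Q y := connect r h y \/ exists a c,
  [/\ a \in pred2 (s e) (t e), c \in pred2 (s e) (t e), connect r h a & connect r c y].
have Qstep x y : Q x -> step (e |: A) B X x y -> Q y.
  move=> Qx /stepP xy.
  have [rxy|[xe ye]] : r x y \/ x \in pred2 (s e) (t e) /\ y \in pred2 (s e) (t e).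
    case: xy => [/linkP[f + xy]|xyB]; last by left; apply/stepP; right.
    rewrite !inE => /predU1P[fe|fA].
      by right; rewrite -fe; case: xy => -[-> ->]; rewrite !eqxx orbT.
    by left; apply/stepP; left; apply/linkP; exists f.
  - case: Qx => [hx|[a [c [ae ce ha cx]]]].
      by left; apply: connect_trans hx (connect1 rxy).
    by right; exists a, c; split=> //; apply: connect_trans cx (connect1 rxy).
  - case: Qx => [hx|[a [c [ae ce ha cx]]]]; right; first by exists x, y.
    by exists a, y.
apply/negP => /(connect_ind (Q := Q) (or_introl (connect0 _ _)) Qstep).
case=> [|[a [c [+ + ha ck]]]]; first exact/negP.
have ca : connect r c a := connect_trans ck (connect_trans rkh ha).
have [ac|ne_ac] := eqVneq a c.
  by case/negP: no_hk; apply: connect_trans ha _; rewrite ac.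
rewrite !inE => /orP[]/eqP a_e /orP[]/eqP c_e; rewrite a_e c_e ?eqxx // in ne_ac ca.
  by rewrite ca in no_ts.
by rewrite ca in no_st.
Qed.

(** [Y0] and [Y1] consist of the orientations of [B] that remain acyclic when [e] is added in one
    direction, respectively the other. Their union is bounded by the deletion term and their
    intersection by the contraction term. *)
Lemma nao_delete_contract A B e : e \notin B ->
  nao A (e |: B) <= nao A B + nao (e |: A) B.
Proof.
move=> eB; pose Y0 := [set X : {set E} | X \subset B & acyc A (e |: B) X].
pose Y1 := [set X : {set E} | X \subset B & acyc A (e |: B) (e |: X)].
have leY : nao A (e |: B) <= #|Y0| + #|Y1|.
  rewrite /nao -(cardsID [set X : {set E} | e \in X] (acyclics A (e |: B))) addnC.
  apply: leq_add.
    apply: subset_leq_card; apply/subsetP => X; rewrite !inE.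
    by move=> /and3P[eX XB ->]; rewrite andbT; rewrite -(setU1K eB) subsetD1 XB.
  have del_inj : {in acyclics A (e |: B) :&: [set X : {set E} | e \in X] &,
      injective (fun X : {set E} => X :\ e)}.
    move=> X X'; rewrite !inE => /andP[_ eX] /andP[_ eX'] eq_X.
    by rewrite -(setD1K eX) eq_X setD1K.
  rewrite -(card_in_imset del_inj).
  apply: subset_leq_card; apply/subsetP => _ /imsetP[X + ->]; rewrite !inE.
  move=> /andP[/andP[XB acX] eX]; rewrite setD1K // acX andbT.
  by rewrite -(setU1K eB) setSD.
apply: leq_trans leY _; rewrite -cardsUI; apply: leq_add.
  apply: subset_leq_card; apply/subsetP => X; rewrite !inE.
  have eqX : {in B, X =i e |: X}.
    by move=> g gB; rewrite !inE; case: eqP gB eB => [->->|].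
  case/orP => /andP[-> /forall_inP acX]; apply/forall_inP => f fB;
    have := acX f; rewrite !inE fB orbT => /(_ isT); apply: contra.
    by apply: connect_step_sub => //; apply: subsetUr.
  rewrite /oriented -eqX //; apply: connect_step_sub => //; exact: subsetUr.
apply: subset_leq_card; apply/subsetP => X; rewrite !inE.
by move=> /andP[/andP[XB ac0] /andP[_ ac1]]; rewrite XB acyclic_both.
Qed.

End Minors.

(** * Circuits *)

Lemma eq_set2 (T : finType) (a b u v : T) :
  [set a; b] = [set u; v] -> (u, v) = (a, b) \/ (u, v) = (b, a).
Proof.
move=> ab_uv; have /set2P[] : u \in [set a; b] by rewrite ab_uv set21.
  move=> ua; have /set2P[] : b \in [set u; v] by rewrite -ab_uv set22.
    have /set2P[] : v \in [set a; b] by rewrite ab_uv set22.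
      by move=> -> bu; left; rewrite bu ua.
    by move=> -> _; left; rewrite ua.
  by move=> ->; left; rewrite ua.
move=> ub; have /set2P[] : a \in [set u; v] by rewrite -ab_uv set21.
  have /set2P[] : v \in [set a; b] by rewrite ab_uv set22.
    by move=> -> _; right; rewrite ub.
  by move=> -> au; left; rewrite au ub.
by move=> ->; right; rewrite ub.
Qed.

Section Circuits.

Variables (G : multigraph) (s t : edge G -> vertex G).
Hypothesis ends_st : forall e, ends e = [set s e; t e].

Local Notation link := (link s t).

Lemma adj_link S : adj S =2 link S.
Proof.
move=> u v; apply/exists_inP/linkP => -[e eS].
  by rewrite ends_st => /eqP/eq_set2 uv; exists e.
by move=> uv; exists e => //; rewrite ends_st; case: uv => -[-> ->] //; rewrite setUC.
Qed.

Lemma connect_adj S : connect (adj S) =2 connect (link S).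
Proof. exact/eq_connect/adj_link. Qed.

(** The rest of the cycle, followed from [v (ordS i)] round to [v i] in [n.-1] steps, never uses
    [e]. *)
Lemma circuit_connect C e : circuit C -> e \in C ->
  connect (link (C :\ e)) (s e) (t e).
Proof.
case/existsP=> n /andP[n_gt0 /existsP[v /existsP[f]]].
case/and4P=> _ /injectiveP f_inj /forallP ends_f /eqP-> /imsetP[i _ def_e].
pose D := [set f i | i : 'I_n] :\ e.
have linkD j : j != i -> link D (v j) (v (ordS j)).
  move=> ne_ji; rewrite -adj_link; apply/exists_inP; exists (f j) => //.
  by rewrite !inE def_e (inj_eq f_inj) ne_ji imset_f.
have iterE k : nat_of_ord (iter k (@ordS n) (ordS i)) = (i.+1 + k) %% n.
  elim: k => [|k IHk]; first by rewrite addn0.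
  by rewrite iterS /= IHk -addn1 modnDml addn1 addnS.
have around k : k < n -> connect (link D) (v (ordS i)) (v (iter k (@ordS n) (ordS i))).
  elim: k => // k IHk ltkn; apply: connect_trans (IHk (ltnW ltkn)) _.
  apply/connect1/linkD/eqP => /(congr1 (@nat_of_ord n)); rewrite iterE.
  have lt_in := ltn_ord i; have [lt|ge] := ltnP (i.+1 + k) n.
    by rewrite modn_small //; lia.
  by rewrite -(subnK ge) modnDr modn_small; lia.
have /around : n.-1 < n by rewrite prednK.
have ->: iter n.-1 (@ordS n) (ordS i) = i.
  apply: val_inj; rewrite /= iterE addSnnS prednK //.
  by rewrite modnDr modn_small.
have /eqP := ends_f i; rewrite -def_e ends_st => /eq_set2[] [-> ->] //.
by rewrite connect_linkC.
Qed.

(** A path without repeated vertices is closed up by [e], which receives the last index [size p]. *)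
Lemma circuit_of_path (A : {set edge G}) e : s e != t e -> e \notin A ->
  connect (link A) (s e) (t e) ->
  exists C, [/\ circuit C, e \in C & C \subset e |: A].
Proof.
move=> ne_st eA /connectP[p0 p0_path def_t].
case: (shortenP p0_path) def_t => p p_path p_uniq _ def_t.
pose n := (size p).+1; pose w := s e :: p.
have p_gt0 : 0 < size p.
  by case: (p) def_t => //= se; rewrite se eqxx in ne_st.
have le_n : n < (nvertices G).+1.
  by rewrite ltnS -[n]/(size w) -(card_uniqP p_uniq) max_card.
pose v : {ffun 'I_n -> vertex G} := [ffun i : 'I_n => nth (s e) w i].
have v_inj : injective v.
  move=> i j; rewrite !ffunE => /eqP; rewrite nth_uniq ?ltn_ord // => /eqP.
  exact: val_inj.
have next_v (i : 'I_n) : i < size p -> v (ordS i) = nth (s e) w i.+1.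
  by move=> lt_i; rewrite ffunE /= modn_small.
have wrap (i : 'I_n) : ~~ (i < size p) -> v i = t e /\ v (ordS i) = s e.
  rewrite -leqNgt => le_i; have ip : i = size p :> nat.
    by apply/eqP; rewrite eqn_leq le_i -ltnS ltn_ord.
  by rewrite !ffunE /= ip modnn /= def_t (last_nth (s e)).
have /fin_all_exists[f0 f0P] (i : 'I_n) : exists f,
    ends f = [set v i; v (ordS i)] /\ (if i < size p then f \in A : Prop else f = e).
  case: (boolP (i < size p)) => lt_i; last first.
    by exists e; have [-> ->] := wrap i lt_i; rewrite ends_st setUC.
  have := pathP (s e) p_path i lt_i; rewrite -adj_link.
  by case/exists_inP=> f fA /eqP ends_f; exists f; rewrite next_v // ffunE.
pose f := finfun f0.
have fP i : ends (f i) = [set v i; v (ordS i)] /\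
    (if i < size p then f i \in A : Prop else f i = e).
  by rewrite ffunE; apply: f0P.
have f_inj : injective f.
  move=> i j fij; have [ends_i fi] := fP i; have [ends_j fj] := fP j.
  move: fi fj; rewrite fij; case: ifPn => lt_i; case: ifPn => lt_j.
  (* Two steps along the same edge have the same pair of ends; if these were swapped, each index
     would be the successor of the other. *)
  - move=> _ _; move: ends_i; rewrite fij ends_j => /eq_set2[] [vi vi'].
      exact: v_inj.
    have /(congr1 (@nat_of_ord n))/= := v_inj _ _ vi.
    have /(congr1 (@nat_of_ord n))/= := v_inj _ _ vi'.
    by rewrite !modn_small ?ltnS //; lia.
  - by move=> + fe; rewrite fe (negPf eA).
  - by move=> fe; rewrite fe (negPf eA).
  - move=> _ _; apply: val_inj; move: lt_i lt_j; rewrite -!leqNgt => le_i le_j.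
    by apply/eqP; rewrite eqn_leq (leq_trans _ le_j) ?(leq_trans _ le_i) // -ltnS ltn_ord.
exists [set f i | i : 'I_n]; split.
- apply/existsP; exists (Ordinal le_n); rewrite /=.
  apply/existsP; exists v; apply/existsP; exists f; apply/and4P; split=> //.
  + exact/injectiveP.
  + exact/injectiveP.
  + by apply/forallP => i; have [-> _] := fP i.
- apply/imsetP; exists ord_max => //; have [_] := fP ord_max.
  by rewrite ltnn.
- apply/subsetP => _ /imsetP[i _ ->]; have [_] := fP i; rewrite !inE.
  by case: ifP => _ => [->|->]; rewrite ?eqxx ?orbT.
Qed.

End Circuits.

Local Open Scope ring_scope.

(** * Regular sequences *)

Section RegularSequences.

Variable R : comNzRingType.
Implicit Types (I J : R -> Prop) (a b f g t x : R) (ts : seq R).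

Definition is_ideal I : Prop :=
  [/\ I 0, forall f g, I f -> I g -> I (f + g) & forall a f, I f -> I (a * f)].

Definition adjoin I t f : Prop := exists a b, I a /\ f = a + t * b.

Definition adjoins I ts : R -> Prop := foldl adjoin I ts.

Definition colon I x f : Prop := I (x * f).

(** Regularity in the weak sense: the quotients may be zero, because the unit ideal does occur among
    the ideals of minors. *)
Fixpoint regular I ts : Prop :=
  if ts is t :: ts' then
    (forall f, I (t * f) -> I f) /\ regular (adjoin I t) ts'
  else True.

Lemma idealB I f g : is_ideal I -> I f -> I g -> I (f - g).
Proof. by case=> _ ID IM If Ig; apply: ID => //; rewrite -mulN1r; apply: IM. Qed.

Lemma ideal_sum I (K : Type) (r : seq K) (Q : pred K) (F : K -> R) :
  is_ideal I -> (forall i, Q i -> I (F i)) -> I (\sum_(i <- r | Q i) F i).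
Proof. by case=> I0 ID _ IF; elim/big_ind: _. Qed.

Lemma adjoin_ideal I t : is_ideal I -> is_ideal (adjoin I t).
Proof.
move=> [I0 ID IM]; split.
- by exists 0, 0; rewrite mulr0 addr0.
- move=> _ _ [a [b [Ia ->]]] [a' [b' [Ia' ->]]].
  by exists (a + a'), (b + b'); split; [exact: ID | rewrite mulrDr addrACA].
- move=> c _ [a [b [Ia ->]]]; exists (c * a), (c * b).
  by split; [exact: IM | rewrite mulrDr (mulrCA t)].
Qed.

Lemma sub_adjoin I t f : I f -> adjoin I t f.
Proof. by exists f, 0; rewrite mulr0 addr0. Qed.

Lemma adjoin_mul I t b : is_ideal I -> adjoin I t (t * b).
Proof. by case=> I0 _ _; exists 0, b; rewrite add0r. Qed.

Lemma adjoin_mono I J t f : (forall g, I g -> J g) -> adjoin I t f -> adjoin J t f.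
Proof. by move=> IJ [a [b [Ia ->]]]; exists a, b; split; [apply: IJ|]. Qed.

Lemma adjoinC I t x f : adjoin (adjoin I t) x f -> adjoin (adjoin I x) t f.
Proof.
move=> [_ [b [[a [c [Ia ->]]] ->]]]; exists (a + x * b), c.
by split; [exists a, b | rewrite addrAC].
Qed.

Lemma adjoins_ideal I ts : is_ideal I -> is_ideal (adjoins I ts).
Proof. by elim: ts I => //= t ts IHts I /(adjoin_ideal t)/IHts. Qed.

Lemma adjoins_mono I J ts f :
  (forall g, I g -> J g) -> adjoins I ts f -> adjoins J ts f.
Proof.
elim: ts I J => [|t ts IHts] I J IJ; first exact: IJ.
by apply: IHts => g; apply: adjoin_mono.
Qed.

Lemma sub_adjoins I ts f : I f -> adjoins I ts f.
Proof. by elim: ts I => //= t ts IHts I If; apply/IHts/sub_adjoin. Qed.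

Lemma mem_adjoins I ts t : is_ideal I -> t \in ts -> adjoins I ts t.
Proof.
elim: ts I => //= u ts IHts I idI; rewrite inE => /predU1P[->|/IHts]; last first.
  by apply; apply: adjoin_ideal.
by apply: sub_adjoins; have:= adjoin_mul u 1 idI; rewrite mulr1.
Qed.

Lemma adjoins_min I J ts f : is_ideal J ->
  (forall g, I g -> J g) -> {in ts, forall t, J t} -> adjoins I ts f -> J f.
Proof.
move=> [_ JD JM]; elim: ts I => [|t ts IHts] I IJ tsJ; first exact: IJ.
apply: IHts => [_ [a [b [/IJ Ja ->]]]|u uts]; last by apply: tsJ; rewrite inE uts orbT.
by apply: JD => //; rewrite mulrC; apply/JM/tsJ/mem_head.
Qed.

Lemma regular_eq I J ts :
  (forall f, I f <-> J f) -> regular I ts -> regular J ts.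
Proof.
elim: ts I J => //= t ts IHts I J eqIJ [regt regts]; split.
  by move=> f /eqIJ/regt/eqIJ.
by apply: IHts regts => f; split; apply: adjoin_mono => g /eqIJ.
Qed.

Lemma regular_full I ts : (forall f, I f) -> regular I ts.
Proof.
elim: ts I => //= t ts IHts I fI; split=> //.
by apply: IHts => f; apply: sub_adjoin.
Qed.

(** If [x * g = a + t * b], then [t * b] lies in [I + (x)], hence so does [b = a' + x * c], and
    [x * (g - t * c) = a + t * a'] lies in [I]. *)
Lemma adjoin_colon I t x g : is_ideal I ->
  (forall b, adjoin I x (t * b) -> adjoin I x b) ->
  adjoin I t (x * g) -> adjoin (colon I x) t g.
Proof.
move=> idI regt [a [b [Ia def_xg]]]; have [_ ID IM] := idI.
have /regt[a' [c [Ia' def_b]]]: adjoin I x (t * b).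
  exists (- a), g; split; first by rewrite -mulN1r; apply: IM.
  by rewrite def_xg addKr.
exists (g - t * c), c; split; last by rewrite subrK.
rewrite /colon mulrBr def_xg def_b mulrDr (mulrCA t) addrA addrK.
by apply: ID => //; apply: IM.
Qed.

Lemma colon_adjoin I t x g :
  adjoin (colon I x) t g -> colon (adjoin I t) x g.
Proof.
move=> [a [b [Ixa ->]]]; exists (x * a), (x * b).
by rewrite mulrDr (mulrCA x t).
Qed.

(** Multiplication by [x] from [R/(I : x)] to [R/I] stays injective after dividing both by [ts],
    when [ts] is regular on the cokernel. *)
Lemma adjoins_colon I ts x g : is_ideal I ->
  regular (adjoin I x) ts -> adjoins I ts (x * g) -> adjoins (colon I x) ts g.
Proof.
elim: ts I => //= t ts IHts I idI [regt regts] Jxg.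
have: adjoins (colon (adjoin I t) x) ts g.
  apply: IHts => //; first exact: adjoin_ideal.
  by apply: regular_eq regts => f; split; apply: adjoinC.
by apply: adjoins_mono => f; apply: adjoin_colon.
Qed.

(** In the exact sequence of [R/(I : x)], [R/I] and [R/(I + (x))], an element regular on both outer
    terms is regular on the middle one. By [adjoin_colon] the quotients by it form a sequence of the
    same kind. *)
Lemma regular_colon_adjoin I ts x : is_ideal I ->
  regular (colon I x) ts -> regular (adjoin I x) ts -> regular I ts.
Proof.
elim: ts I => //= t ts IHts I idI [regc regcs] [rega regas]; split.
  move=> f Itf; have /rega[a [b [Ia def_f]]] := sub_adjoin x Itf.
  have [_ ID IM] := idI; rewrite def_f; apply: ID => //.
  apply: regc; rewrite /colon mulrCA.
  have ->: t * (x * b) = t * f - t * a by rewrite def_f mulrDr addrAC subrr add0r.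
  by apply: idealB => //; apply: IM.
apply: IHts; first exact: adjoin_ideal.
- apply: regular_eq regcs => f; split; first exact: colon_adjoin.
  exact: adjoin_colon.
- by apply: regular_eq regas => f; split; apply: adjoinC.
Qed.

End RegularSequences.

(** * Ideals of linear forms and monomial ideals *)

Section LinearForms.

Variables (F : fieldType) (n : nat).
Local Notation S := {mpoly F[n]}.
Implicit Types (f g : S) (a u : 'rV[F]_n) (J : S -> Prop).

Definition lin a : S := \sum_i a 0 i *: 'X_i.

Definition linsubst (M : 'M[F]_n) : S -> S :=
  comp_mpoly [tuple lin (row i M) | i < n].

HB.instance Definition _ M := GRing.RMorphism.on (linsubst M).
HB.instance Definition _ M := GRing.Linear.on (linsubst M).

Lemma linD a b : lin (a + b) = lin a + lin b.
Proof. by rewrite -big_split; apply: eq_bigr => i _; rewrite mxE scalerDl. Qed.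

Lemma linZ c a : lin (c *: a) = c *: lin a.
Proof. by rewrite scaler_sumr; apply: eq_bigr => i _; rewrite mxE scalerA. Qed.

Lemma lin0 : lin 0 = 0.
Proof. by rewrite -[0](scale0r 0) linZ scale0r. Qed.

Lemma lin_sum (I : Type) (r : seq I) (P : pred I) (a_ : I -> 'rV[F]_n) :
  lin (\sum_(i <- r | P i) a_ i) = \sum_(i <- r | P i) lin (a_ i).
Proof. by apply: (big_morph lin linD lin0). Qed.

Lemma mcoeff_lin a i : (lin a)@_U_(i) = a 0 i.
Proof.
rewrite linear_sum (bigD1 i) //= mcoeffZ mcoeffXU eqxx mulr1.
rewrite big1 ?addr0 // => j /negPf ne_ji.
by rewrite mcoeffZ mcoeffXU ne_ji mulr0.
Qed.

Lemma lin_eq0 a : lin a = 0 -> a = 0.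
Proof. by move=> a0; apply/rowP=> i; rewrite -mcoeff_lin a0 mcoeff0 mxE. Qed.

Lemma dhomog_lin a : lin a \is 1.-homog.
Proof. by apply: rpred_sum => i _; apply: rpredZ; rewrite dhomogX /= mdeg1. Qed.

Lemma linsubstXU M i : linsubst M 'X_i = lin (row i M).
Proof. by rewrite /linsubst comp_mpolyXU -tnth_nth tnth_mktuple. Qed.

Lemma linsubst_lin M a : linsubst M (lin a) = lin (a *m M).
Proof.
rewrite mulmx_sum_row lin_sum linear_sum; apply: eq_bigr => i _.
by rewrite linearZ /= linsubstXU linZ.
Qed.

(** A linear map whose kernel is the row space of [B], as [pinvmx B *m B] fixes that space. *)
Definition comp_proj m (B : 'M[F]_(m, n)) : 'M[F]_n := 1%:M - pinvmx B *m B.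

Lemma comp_projE m (B : 'M[F]_(m, n)) a :
  a *m comp_proj B = a - a *m pinvmx B *m B.
Proof. by rewrite mulmxBr mulmx1 mulmxA. Qed.

Lemma comp_proj_eq0 m (B : 'M[F]_(m, n)) a :
  (a *m comp_proj B == 0) = (a <= B)%MS.
Proof.
rewrite comp_projE subr_eq0; apply/eqP/idP => [->|]; first exact: submxMl.
by move/mulmxKpV.
Qed.

(* The ideal generated by the linear forms in the row space of [B], presented
   as the kernel of an endomorphism of a domain. *)
Definition lin_ideal m (B : 'M[F]_(m, n)) f : Prop :=
  linsubst (comp_proj B) f = 0.

Lemma lin_ideal_ideal m (B : 'M[F]_(m, n)) : is_ideal (lin_ideal B).
Proof.
rewrite /lin_ideal; split=> [|f g f0 g0|a f f0]; first exact: rmorph0.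
  by rewrite rmorphD /= f0 g0 addr0.
by rewrite rmorphM /= f0 mulr0.
Qed.

Lemma lin_ideal_lin m (B : 'M[F]_(m, n)) a :
  lin_ideal B (lin a) <-> (a <= B)%MS.
Proof.
rewrite /lin_ideal linsubst_lin -comp_proj_eq0.
by split=> [/lin_eq0 ->|/eqP ->]; rewrite ?lin0.
Qed.

(** The property is stable under sums and products and holds for each variable, which the
    substitution changes by a linear form in the row space of [B]. *)
Lemma sub_linsubst m (B : 'M[F]_(m, n)) J f :
    is_ideal J -> (forall a, (a <= B)%MS -> J (lin a)) ->
  J (f - linsubst (comp_proj B) f).
Proof.
move=> idJ BJ; have [J0 JD JM] := idJ; set psi := linsubst _.
have psiM g h : psi (g * h) = psi g * psi h by exact: rmorphM.
have psiD g h : psi (g + h) = psi g + psi h by exact: rmorphD.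
have psiZ c g : psi (c *: g) = c *: psi g by exact: linearZ.
have psi1 : psi 1 = 1 by exact: rmorph1.
have psi0 : psi 0 = 0 by exact: rmorph0.
pose Q g := J (g - psi g).
have QM g h : Q g -> Q h -> Q (g * h).
  rewrite /Q psiM => Qg Qh.
  have ->: g * h - psi g * psi h = g * (h - psi h) + psi h * (g - psi g).
    by rewrite !mulrBr addrA (mulrC (psi h) g) subrK (mulrC (psi h)).
  by apply: JD; apply: JM.
have Q1 : Q 1 by rewrite /Q psi1 subrr.
have QX i : Q 'X_i.
  rewrite /Q /psi linsubstXU.
  have ->: 'X_i = lin (delta_mx 0 i).
    rewrite /lin (bigD1 i) //= mxE !eqxx scale1r big1 ?addr0 // => j /negPf ne_ji.
    by rewrite mxE ne_ji andbF scale0r.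
  rewrite rowE -scaleN1r -linZ -linD scaleN1r; apply: BJ.
  by rewrite comp_projE opprB addrCA subrr addr0 submxMl.
clearbody psi; rewrite -/(Q f) [f]mpolyE; elim/big_ind: _ => [|g h Qg Qh|m' _].
- by rewrite /Q psi0 subrr.
- by rewrite /Q psiD opprD addrACA; apply: JD.
- rewrite /Q psiZ -scalerBr -mul_mpolyC; apply: JM.
  rewrite mpolyXE_id -/(Q _); elim/big_ind: _ => // i _.
  by elim: (m' i) => [|k IHk]; rewrite ?expr0 // exprS; apply: QM.
Qed.

Lemma lin_ideal_min m (B : 'M[F]_(m, n)) J f :
    is_ideal J -> (forall a, (a <= B)%MS -> J (lin a)) ->
  lin_ideal B f -> J f.
Proof. by move=> idJ /(sub_linsubst f idJ) + f0; rewrite f0 subr0. Qed.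

Lemma adjoin_lin_ideal m (B : 'M[F]_(m, n)) a f :
  adjoin (lin_ideal B) (lin a) f <-> lin_ideal (col_mx B a) f.
Proof.
have idB := lin_ideal_ideal B; have [_ ID IM] := lin_ideal_ideal (col_mx B a).
split=> [[g [h [Bg ->]]]|].
  apply: ID; last first.
    rewrite mulrC; apply/IM/lin_ideal_lin.
    by rewrite -addsmxE addsmxSr.
  apply: lin_ideal_min Bg; first exact: lin_ideal_ideal.
  move=> b /submx_trans le_b; apply/lin_ideal_lin/le_b.
  by rewrite -addsmxE addsmxSl.
apply: lin_ideal_min; first exact: adjoin_ideal.
move=> u; rewrite -addsmxE => /sub_addsmxP[[v w] /= ->].
exists (lin (v *m B)), (w 0 0)%:MP; split.
  by apply/lin_ideal_lin/submxMl.
rewrite linD (mulrC (lin a)) mul_mpolyC -linZ.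
by rewrite {1}[w]mx11_scalar mul_scalar_mx.
Qed.

Fixpoint lin_free m (B : 'M[F]_(m, n)) (s : seq 'rV[F]_n) : Prop :=
  if s is a :: s' then ~~ (a <= B)%MS /\ lin_free (col_mx B a) s' else True.

(** Modulo an ideal generated by linear forms the ring is a domain, so a form outside the span of
    the previous ones is regular. *)
Lemma regular_lin_ideal m (B : 'M[F]_(m, n)) s :
  lin_free B s -> regular (lin_ideal B) (map lin s).
Proof.
elim: s m B => //= a s IHs m B [aB /IHs freeBa]; split=> [f|].
  rewrite /lin_ideal rmorphM /= => /eqP; rewrite mulf_eq0 => /orP[|/eqP//].
  by move/eqP/lin_ideal_lin; rewrite (negPf aB).
by apply: regular_eq freeBa => f; rewrite adjoin_lin_ideal.
Qed.

End LinearForms.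

(** * Monomial ideals *)

Section MonomialIdeals.

Variables (F : fieldType) (n : nat).
Local Notation S := {mpoly F[n]}.
Implicit Types (f g : S) (bad : pred 'X_{1..n}) (m : 'X_{1..n}).

Definition upward bad : Prop := forall m m', bad m -> bad (m + m')%MM.

(** For [upward] predicates this is the ideal spanned by the bad monomials. Testing membership term
    by term reduces colons and sums with a variable to operations on predicates. *)
Definition mono_ideal bad f : Prop := {in msupp f, forall m, bad m}.

Lemma mono_ideal_ideal bad : upward bad -> is_ideal (mono_ideal bad).
Proof.
move=> up; split=> [m|f g bf bg m|a f bf m].
- by rewrite msupp0.
- by move/msuppD_le; rewrite mem_cat => /orP[/bf|/bg].
- by move/msuppM_le/allpairsP=> [[m1 m2] /= [_ /bf/up + ->]]; rewrite addmC.
Qed.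

Lemma mono_idealX bad m : mono_ideal bad ('X_[m] : S) <-> bad m.
Proof.
split=> [|bm m']; first by apply; rewrite msuppX mem_head.
by rewrite msuppX inE => /eqP->.
Qed.

Lemma eq_mono_ideal bad bad' f : bad =1 bad' ->
  mono_ideal bad f <-> mono_ideal bad' f.
Proof. by move=> e; split=> bf m /bf; rewrite e. Qed.

Lemma colon_mono_ideal bad (i : 'I_n) f :
  colon (mono_ideal bad) 'X_i f <-> mono_ideal (fun m => bad (U_(i) + m)%MM) f.
Proof.
rewrite /colon mulrC; split=> bf m.
  by move=> mf; apply: bf; rewrite (perm_mem (msuppMX _ _)) map_f.
by rewrite (perm_mem (msuppMX _ _)) => /mapP[m' /bf + ->].
Qed.

Lemma mono_ideal_terms (J : S -> Prop) bad f : is_ideal J ->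
  (forall m, bad m -> J 'X_[m]) -> mono_ideal bad f -> J f.
Proof.
move=> idJ bJ bf; have [_ _ JM] := idJ.
rewrite [f]mpolyE big_seq; apply: ideal_sum => // m /bf/bJ Jm.
by rewrite -mul_mpolyC; apply: JM.
Qed.

Lemma mpolyX_dvd m (i : 'I_n) : (0 < m i)%N ->
  'X_[m] = 'X_i * 'X_[m - U_(i)] :> S.
Proof. by move=> mi; rewrite -mpolyXD addmC submK // lep1mP -lt0n. Qed.

Lemma adjoin_mono_ideal bad (i : 'I_n) f : upward bad ->
  adjoin (mono_ideal bad) 'X_i f <->
  mono_ideal (fun m => bad m || (0 < m i)%N) f.
Proof.
move=> up; have idb := mono_ideal_ideal up; split; last first.
  apply: mono_ideal_terms; first exact: adjoin_ideal.
  move=> m /orP[bm|mi]; first by apply/sub_adjoin/mono_idealX.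
  by rewrite (mpolyX_dvd mi); apply: adjoin_mul.
move=> [a [b [ba ->]]] m /msuppD_le; rewrite mem_cat => /orP[/ba-> //|].
rewrite mulrC (perm_mem (msuppMX _ _)) => /mapP[m' _ ->].
by rewrite mnmDE mnm1E eqxx orbT.
Qed.

(** An ideal generated by variables is both linear and monomial; this passes from the side where
    regularity is known to the side of broken circuits. *)
Lemma mono_ideal_vars (D : {set 'I_n}) f :
  lin_ideal (diag_mx (\row_i (i \in D)%:R : 'rV[F]_n)) f <->
  mono_ideal (fun m => [exists i in D, 0 < m i]%N) f.
Proof.
set B := diag_mx _; set bad := fun m => _.
have up : upward bad.
  move=> m m' /exists_inP[i iD mi]; apply/exists_inP; exists i => //.
  by rewrite mnmDE ltn_addr.
split; last first.
  apply: mono_ideal_terms; first exact: lin_ideal_ideal.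
  move=> m /exists_inP[i iD mi]; rewrite (mpolyX_dvd mi).
  have [_ _ IM] := lin_ideal_ideal B; rewrite mulrC; apply: IM.
  have ->: 'X_i = lin (row i B).
    rewrite /lin (bigD1 i) //= big1 ?addr0 => [|j /negPf ne_ji].
      by rewrite !mxE eqxx mulr1n iD scale1r.
    by rewrite !mxE eq_sym ne_ji mulr0n scale0r.
  by apply/lin_ideal_lin/row_sub.
apply: lin_ideal_min; first exact: mono_ideal_ideal.
move=> _ /submxP[u ->]; apply: ideal_sum => [|i _]; first exact: mono_ideal_ideal.
have [I0 _ IM] := mono_ideal_ideal up.
rewrite mul_mx_diag !mxE; case: (boolP (i \in D)) => iD; last first.
  by rewrite mulr0 scale0r.
rewrite -mul_mpolyC; apply/IM/mono_idealX.
by apply/exists_inP; exists i => //; rewrite mnm1E eqxx.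
Qed.

(** * Graded ideals and dimensions of their quotients *)

Definition graded (I : S -> Prop) : Prop :=
  forall d f, I f -> I (pihomog mdeg d f).

Lemma mono_ideal_graded bad : upward bad -> graded (mono_ideal bad).
Proof.
move=> up d f bf; have [_ _ IM] := mono_ideal_ideal up.
rewrite pihomogE big_seq_cond; apply: ideal_sum; first exact: mono_ideal_ideal.
by move=> m /andP[/bf bm _]; rewrite -mul_mpolyC; apply/IM/mono_idealX.
Qed.

Lemma adjoin_graded (I : S -> Prop) t :
  t \is 1.-homog -> graded I -> graded (adjoin I t).
Proof.
move=> t1 grI d _ [a [b [Ia ->]]].
exists (pihomog mdeg d a); rewrite pihomogD.
pose K := mmeasure mdeg b.
(* This is the component of [b] of degree [d - 1], read as zero when [d = 0]. *)
exists (\sum_(k < K | k.+1 == d) pihomog mdeg k b); split; first exact: grI.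
congr (_ + _); rewrite {1}[b](@pihomog_partitionE _ _ mdeg K) //.
rewrite mulr_sumr linear_sum mulr_sumr [RHS]big_mkcond; apply: eq_bigr => k _.
have tb: t * pihomog mdeg k b \is k.+1.-homog.
  by rewrite -[k.+1]add1n dhomogM // pihomogP.
case: eqP => [<-|/eqP ne] /=; first by rewrite pihomog_dE.
by rewrite (pihomog_ne0 ne).
Qed.

Lemma adjoins_graded (I : S -> Prop) ts :
  {in ts, forall t, t \is 1.-homog} -> graded I -> graded (adjoins I ts).
Proof.
elim: ts I => //= t ts IHts I ts1 grI; apply: IHts.
  by move=> u uts; apply: ts1; rewrite inE uts orbT.
by apply: adjoin_graded => //; apply/ts1/mem_head.
Qed.

(** This certifies that the degree [d] part of [S/I] has dimension at least [N], without forming the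
    quotient. *)
Definition indep_mod (I : S -> Prop) d N : Prop :=
  exists f : 'I_N -> S, (forall k, f k \is d.-homog) /\
    forall c : 'I_N -> F, I (\sum_k c k *: f k) -> forall k, c k = 0.

Lemma indep_mod0 (I : S -> Prop) d : indep_mod I d 0.
Proof. by exists (fun=> 0); split=> [i|c _ []//]; apply: dhomog0. Qed.

Lemma indep_mod_sub (I J : S -> Prop) d N :
  (forall f, J f -> I f) -> indep_mod I d N -> indep_mod J d N.
Proof. by move=> JI [f [fd If]]; exists f; split=> // c /JI/If. Qed.

(** The family consists of the ['X_i * f k] and the [g k]. Modulo ['X_i] only the [g k] survive, so
    their coefficients vanish; [adjoins_colon] then cancels ['X_i] from the rest. *)
Lemma indep_mod_split (I : S -> Prop) (i : 'I_n) ts d N1 N2 :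
    is_ideal I -> regular (adjoin I 'X_i) ts ->
    indep_mod (adjoins (colon I 'X_i) ts) d N1 ->
    indep_mod (adjoins (adjoin I 'X_i) ts) d.+1 N2 ->
  indep_mod (adjoins I ts) d.+1 (N1 + N2).
Proof.
move=> idI reg [f [fd If]] [g [gd Ig]].
exists (fun k => match split k with inl k1 => 'X_i * f k1 | inr k2 => g k2 end).
split=> [k|c]; first case: splitP => k' _.
- by rewrite -add1n dhomogM // dhomogX /= mdeg1.
- exact: gd.
rewrite big_split_ord /=.
under eq_bigr do rewrite (unsplitK (inl _)) scalerAr.
under [X in _ + X]eq_bigr do rewrite (unsplitK (inr _)).
rewrite -mulr_sumr; set f' := \sum__ _; set g' := \sum__ _ => Jfg.
have idJ := adjoins_ideal ts (adjoin_ideal 'X_i idI).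
have c2 j : c (rshift N1 j) = 0.
  move: j; apply: (Ig (fun j => c (rshift N1 j))).
  have ->: \sum_j c (rshift N1 j) *: g j = ('X_i * f' + g') - 'X_i * f'.
    by rewrite addrC addKr.
  apply: idealB => //; last exact/sub_adjoins/adjoin_mul.
  by move: Jfg; apply: adjoins_mono => ?; apply: sub_adjoin.
have c1 j : c (lshift N2 j) = 0.
  move: j; apply: (If (fun j => c (lshift N2 j))).
  apply: adjoins_colon => //; move: Jfg; rewrite [g']big1 ?addr0 // => j _.
  by rewrite c2 scale0r.
by move=> k; case: (split_ordP k) => j ->.
Qed.

Lemma indep_mod_leq (I : S -> Prop) d N (A : {set 'X_{1..n < d.+1}}) :
    is_ideal I -> graded I ->
    (forall f, exists g, I (f - g) /\
      forall m (m_d : mdeg m = d), m \in msupp g ->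
        exists2 m' : 'X_{1..n < d.+1}, m' \in A & m = m') ->
  indep_mod I d N -> (N <= #|A|)%N.
Proof.
move=> idI grI span [f [fd If]]; rewrite leqNgt; apply/negP => ltAN.
have [_ _ IM] := idI.
(* Representatives are replaced by their components of degree [d], which is legitimate because [I]
   is graded. *)
have /fin_all_exists[g gP] i : exists g, I (f i - g) /\
    (forall m, m \in msupp g -> exists2 m' : 'X_{1..n < d.+1}, m' \in A & m = m').
  have [g [Ifg gA]] := span (f i); exists (pihomog mdeg d g); split.
    by have := grI d _ Ifg; rewrite pihomogB pihomog_dE.
  move=> m mg; have m_d : mdeg m = d by have /dhomogP := pihomogP mdeg d g; apply.
  apply: gA => //; move: mg; rewrite !mcoeff_msupp pihomogE linear_sum /=.
  apply: contraNneq => gm0; apply/eqP; apply: big1 => m' _.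
  rewrite mcoeffZ mcoeffX; case: eqP => [->|]; rewrite ?mulr0 //.
  by rewrite gm0 mul0r.
(* The coefficient matrix has more rows than columns, so a nontrivial combination of the [g i]
   vanishes. *)
pose M := \matrix_(i < N, j < #|A|) (g i)@_(enum_val j).
have: kermx M != 0.
  rewrite -mxrank_eq0 mxrank_ker -lt0n subn_gt0.
  exact: leq_ltn_trans (rank_leq_col M) ltAN.
case/rowV0Pn => u /sub_kermxP uM /negP; apply; apply/eqP/rowP => i.
rewrite mxE; apply: (If (fun i => u 0 i)) => {i}.
have ->: \sum_i u 0 i *: f i = \sum_i u 0 i *: (f i - g i).
  under [RHS]eq_bigr do rewrite scalerBr.
  rewrite sumrB; suff ->: \sum_i u 0 i *: g i = 0 by rewrite subr0.
  apply/mpolyP => m; rewrite mcoeff0 linear_sum /=.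
  have [/existsP[m' /andP[m'A /eqP <-]]|nA] :=
    boolP [exists m' : 'X_{1..n < d.+1}, (m' \in A) && (val m' == m)].
    have := congr1 (fun X : 'rV_ _ => X 0 (enum_rank_in m'A m')) uM.
    rewrite !mxE => {2}<-; apply: eq_bigr => i _.
    by rewrite !mxE mcoeffZ enum_rankK_in.
  apply: big1 => i _; rewrite mcoeffZ; have [_ gA] := gP i.
  rewrite (memN_msupp_eq0 (m := m)) ?mulr0 //; apply: contra nA.
  by move=> /gA[m' m'A ->]; apply/existsP; exists m'; rewrite m'A /=.
apply: ideal_sum => // i _; rewrite -mul_mpolyC; apply: IM.
by have [] := gP i.
Qed.

End MonomialIdeals.

(** * The broken circuit ideals of the minors *)

Section BrokenCircuitIdeals.

Variables (G : multigraph) (s t : edge G -> vertex G) (o : enumeration G).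
Variable g : edge G -> 'I_(nedges G).
Hypothesis ends_st : forall e, ends e = [set s e; t e].
Hypothesis st_neq : forall e, s e != t e.
Hypotheses (oK : cancel o g) (gK : cancel g o).
Hypothesis treeT : spanning_tree (tree_edges o).

Local Notation q := (nedges G).
Local Notation T := (tree_edges o).
Local Notation link := (link s t).
Local Notation conn := (conn s t).
Local Notation S := {mpoly 'F_2[q]}.
Implicit Types (F : {set edge G}) (e f : edge G) (m : nat) (x : 'X_{1..q}).

(** Circuits are nonempty, so the minimum exists and the default in [broken] is not reached. *)
Lemma brokenP C : circuit C -> exists c,
  [/\ c \in C, broken o C = C :\ c & {in C, forall e, (g c <= g e)%N}].
Proof.
case/existsP=> n /andP[n_gt0 /existsP[v /existsP[f /and4P[_ _ _ /eqP defC]]]].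
have fC : f (Ordinal n_gt0) \in C by rewrite defC imset_f.
rewrite /broken /min_index; case: pickP => [i /andP[iC /forallP minC]|noC].
  exists (o i); split=> // e eC; rewrite oK.
  by have /implyP := minC (g e); rewrite gK; apply.
have gfC : o (g (f (Ordinal n_gt0))) \in C by rewrite gK.
pose c := [arg min_(c < g (f (Ordinal n_gt0)) | o c \in C) nat_of_ord c].
have := noC c; rewrite /c; case: arg_minnP => // i iC minC /negP[].
by rewrite iC /=; apply/forallP => j; apply/implyP/minC.
Qed.

Definition low m : {set edge G} := [set e | (g e < m)%N].
Definition kept m F : {set edge G} := F :|: low m.
Definition edge_supp x : {set edge G} := [set e | (0 < x (g e))%N].

(* Edges of index at least [m] have been processed: those in [F] are contracted
   and the others deleted.  [bad m F] describes the broken circuit ideal of this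
   minor, extended to all the variables. *)
Definition bad m F : pred 'X_{1..q} := fun x =>
  [exists e, [&& (m <= g e)%N, e \notin F & e \in edge_supp x]] ||
  [exists C, circuit C && (broken o C \subset F :|: edge_supp x)].

Definition bc_ideal m F : S -> Prop := mono_ideal (bad m F).

Lemma edge_suppD x y : edge_supp (x + y)%MM = edge_supp x :|: edge_supp y.
Proof. by apply/setP => e; rewrite !inE mnmDE addn_gt0. Qed.

Lemma edge_suppU i : edge_supp U_(i)%MM = [set o i].
Proof.
apply/setP => e; rewrite !inE mnm1E -(can_eq gK) oK eq_sym.
by case: eqP.
Qed.

Lemma bad_upward m F : upward (bad m F).
Proof.
move=> x y /orP[/existsP[e /and3P[me eF ex]]|/existsP[C /andP[circC CF]]].
  by apply/orP; left; apply/existsP; exists e; rewrite me eF edge_suppD inE ex.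
apply/orP; right; apply/existsP; exists C; rewrite circC edge_suppD setUA.
exact: subset_trans CF (subsetUl _ _).
Qed.

Lemma bc_ideal_ideal m F : is_ideal (bc_ideal m F).
Proof. exact/mono_ideal_ideal/bad_upward. Qed.

Section Step.

Variables (m : nat) (ltmq : (m < q)%N) (F : {set edge G}).
Local Notation i := (Ordinal ltmq).
Local Notation e := (o i).
Hypothesis highF : {in F, forall f, (m < g f)%N}.

Lemma last_notin : e \notin F.
Proof. by apply/negP => /highF; rewrite oK ltnn. Qed.

Lemma leq_gE f : (m <= g f)%N = (f == e) || (m < g f)%N.
Proof.
by rewrite leq_eqVlt -(can_eq gK) oK -val_eqE /= [(_ == m)]eq_sym.
Qed.

Lemma low_succ : low m.+1 = e |: low m.
Proof.
by apply/setP => f; rewrite !inE ltnS leq_eqVlt -(can_eq gK) oK -val_eqE.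
Qed.

Lemma last_notin_low : e \notin low m.
Proof. by rewrite inE oK ltnn. Qed.

Lemma kept_contract : kept m (e |: F) = kept m.+1 F.
Proof. by rewrite /kept low_succ setUCA setUA. Qed.

Lemma kept_delete : kept m F = kept m.+1 F :\ e.
Proof.
apply/setP => f; rewrite /kept low_succ !inE.
by have [->|//] := eqVneq f e; rewrite (negPf last_notin) oK /= ltnn.
Qed.

Lemma deleted_contract x : [exists f, [&& (m < g f)%N, f \notin F & f \in edge_supp x]]
  = [exists f, [&& (m <= g f)%N, f \notin e |: F & f \in edge_supp x]].
Proof.
apply: eq_existsb => f; rewrite leq_gE in_setU1 negb_or.
by have [->|] := eqVneq f e; rewrite ?oK ?ltnn.
Qed.

Lemma bad_contract x : bad m.+1 F (U_(i) + x)%MM = bad m (e |: F) x.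
Proof.
rewrite /bad -deleted_contract edge_suppD edge_suppU; congr (_ || _).
  apply: eq_existsb => f; rewrite in_setU1.
  by have [->|] := eqVneq f e; rewrite ?oK ?ltnn.
by apply: eq_existsb => C; rewrite setUCA setUA.
Qed.

Lemma bad_delete x : bad m.+1 F x || (0 < x i)%N = bad m F x.
Proof.
rewrite /bad orbAC; congr (_ || _); apply/orP/existsP => [[/existsP[f]|xi]|[f]].
- by case/and3P=> mf fF fx; exists f; rewrite (ltnW mf) fF.
- by exists e; rewrite last_notin oK leqnn inE oK.
rewrite leq_gE => /and3P[/predU1P[->|mf] fF fx].
  by right; rewrite inE oK in fx.
by left; apply/existsP; exists f; rewrite mf fF.
Qed.

(** If a broken circuit through [e] made [x] bad and no deleted edge did, the whole circuit would
    lie in [kept m.+1 F], and [e] would not be a bridge there. *)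
Lemma bad_bridge x : conn (kept m.+1 F) -> ~~ conn (kept m F) ->
  bad m.+1 F x = bad m (e |: F) x.
Proof.
rewrite kept_delete => /connP cK ncK; rewrite /bad -deleted_contract.
case: (boolP [exists f, _]) => //= /existsPn noD.
apply/existsP/existsP => -[C /andP[circC CF]]; exists C; rewrite circC /=.
  by apply: subset_trans CF _; rewrite -setUA subsetUr.
rewrite -setUA in CF; have [eC|eC] := boolP (e \in broken o C); last first.
  by apply/subsetP => f fC; have := subsetP CF f fC; rewrite inE;
    case/orP=> // /set1P fe; rewrite -fe fC in eC.
have suppK f : f \in edge_supp x -> f \in kept m.+1 F.
  move=> fx; have := noD f; rewrite fx andbT negb_and negbK -leqNgt => /orP[].
    by rewrite !inE ltnS => ->; rewrite orbT.
  by rewrite !inE => ->.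
have [c [cC defC minC]] := brokenP circC.
have {}eC : e \in C /\ e != c by move: eC; rewrite defC !inE => /andP[-> ->].
have [eC_ ne_ec] := eC.
(* The minimum [c] of the circuit precedes [e], so it has not been processed and is kept. *)
have CK : C :\ e \subset kept m.+1 F :\ e.
  apply: setSD; apply/subsetP => f fC; have [->|ne_fc] := eqVneq f c.
    by have := minC e eC_; rewrite oK !inE ltnS => ->; rewrite orbT.
  have := subsetP CF f; rewrite defC !inE ne_fc fC => /(_ isT).
  case/or3P=> [/eqP->|fF|fx].
  + by rewrite oK leqnn orbT.
  + by rewrite fF.
  + by have := suppK f; rewrite !inE; apply.
case/negP: ncK; apply/connP => u v; apply: connect_edges (cK u v) => f fK.
have [->|ne_fe] := eqVneq f e; last by apply/connect1/link_edge; rewrite in_setD1 ne_fe.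
exact: connect_link_sub CK (circuit_connect ends_st circC eC_).
Qed.

Lemma bc_ideal_contract (h : S) :
  colon (bc_ideal m.+1 F) 'X_i h <-> bc_ideal m (e |: F) h.
Proof.
apply: iff_trans (colon_mono_ideal _ _ _) _.
by apply: eq_mono_ideal => x; apply: bad_contract.
Qed.

Lemma bc_ideal_delete (h : S) :
  adjoin (bc_ideal m.+1 F) 'X_i h <-> bc_ideal m F h.
Proof.
apply: iff_trans (adjoin_mono_ideal _ _ (@bad_upward _ _)) _.
by apply: eq_mono_ideal => x; apply: bad_delete.
Qed.

End Step.

(** * Fundamental cuts and regularity of the forms [theta] *)

Definition side j : {set vertex G} :=
  [set v | connect (link (T :\ o j)) (s (o j)) v].

Definition cutvec j : 'rV['F_2]_q := \row_i (o i \in fund_cut o j)%:R.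

Lemma theta_lin j : theta o j = lin (cutvec j).
Proof.
rewrite /theta /lin big_mkcond; apply: eq_bigr => i _; rewrite mxE.
by case: ifP; rewrite ?scale1r ?scale0r.
Qed.

Definition tree_seq : seq 'I_q := [seq j : 'I_q <- enum 'I_q | (nullity G <= j)%N].

Definition thetas : seq S := map (theta o) tree_seq.

Lemma treeP j : (o j \in T) = (nullity G <= j)%N.
Proof.
apply/imsetP/idP => [[k + /(can_inj oK) ->]|jk]; first by rewrite inE.
by exists j; rewrite ?inE.
Qed.

Lemma conn_tree : conn T.
Proof.
apply/connP => u v; rewrite -(connect_adj ends_st).
by case: treeT => -[_ cT] _; apply: cT.
Qed.

Lemma tree_edge_sep e : e \in T -> ~~ connect (link (T :\ e)) (s e) (t e).
Proof.
move=> eT; apply/negP => e_st; have [_ acT] := treeT.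
have [|C [circC _]] := circuit_of_path ends_st (st_neq e) _ e_st.
  by rewrite !inE eqxx.
by rewrite setD1K // (negPf (acT C circC)).
Qed.

Lemma tree_edge_sides e v : e \in T ->
  connect (link (T :\ e)) (s e) v \/ connect (link (T :\ e)) (t e) v.
Proof.
move=> eT; have /connP/(_ (s e) v) := conn_tree.
apply: (@connect_ind _ _ (fun v => connect _ (s e) v \/ connect _ (t e) v)).
  by left.
move=> x y Qx /linkP[f fT xy]; have [fe|ne_fe] := eqVneq f e.
  by case: xy => -[_ ->]; rewrite fe; [right|left].
have lxy : link (T :\ e) x y by apply/linkP; exists f; rewrite // !inE ne_fe.
by case: Qx => /connect_trans Qx; [left|right]; apply/Qx/connect1.
Qed.

(** One direction tests [fund_cut] at the two ends of [o j]; the other uses that the two components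
    of the tree without [o j] cover all vertices. *)
Lemma fund_cutE j f : o j \in T ->
  (f \in fund_cut o j) = ((s f \in side j) != (t f \in side j)).
Proof.
move=> jT; rewrite inE ends_st; have sep := tree_edge_sep jT.
have sideN v : (v \notin side j) -> connect (link (T :\ o j)) (t (o j)) v.
  by rewrite inE => nsv; have [sv|//] := tree_edge_sides v jT; rewrite sv in nsv.
have Nside v : connect (link (T :\ o j)) (t (o j)) v -> v \notin side j.
  rewrite inE => tv; apply: contra sep => sv.
  by rewrite connect_linkC in tv; apply: connect_trans sv tv.
apply/forallP/idP => [cutf|ne_side w].
  have /exists_inP[u] := cutf (s (o j)).
  have /exists_inP[u'] := cutf (t (o j)); rewrite !(connect_adj ends_st).
  move=> u'f /Nside u'N uf su; have {}su : u \in side j by rewrite inE.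
  by case/set2P: u'f u'N => -> u'N; case/set2P: uf su => -> su;
    rewrite ?su ?(negPf u'N) //; rewrite su in u'N.
have [x [y [xf yf xS yS]]] : exists x y : vertex G, [/\ x \in [set s f; t f],
    y \in [set s f; t f], x \in side j & y \notin side j].
  case: (boolP (s f \in side j)) ne_side => sS; case: (boolP (t f \in side j)) => tS // _.
    by exists (s f), (t f); rewrite set21 set22.
  by exists (t f), (s f); rewrite set21 set22.
apply/exists_inP; have [sw|tw] := tree_edge_sides w jT.
  exists x => //; rewrite inE in xS.
  by rewrite (connect_adj ends_st) (connect_trans _ xS) // connect_linkC.
exists y => //; rewrite (connect_adj ends_st) (connect_trans _ (sideN _ yS)) //.
by rewrite connect_linkC.
Qed.

Lemma F2_addrr (a : 'F_2) : a + a = 0.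
Proof. by rewrite -mulr2n -mulr_natr (_ : 2%:R = 0) ?mulr0 //; apply/val_inj. Qed.

(** Over the field with two elements, a cut vector is the coboundary of the indicator function of a
    side. *)
Lemma cutvecE j i : o j \in T ->
  cutvec j 0 i = (s (o i) \in side j)%:R + (t (o i) \in side j)%:R.
Proof.
move=> jT; rewrite mxE fund_cutE //.
by do 2![case: (_ \in side j)]; rewrite ?addr0 ?add0r //= F2_addrr.
Qed.

(* The combinations of the cut vectors are the coboundaries of the vertex
   labellings [l]; one which vanishes on a connected spanning subgraph is zero. *)
Lemma lin_free_cutvec F m (B : 'M['F_2]_(m, q)) js :
    conn F -> uniq js -> {in js, forall j, o j \in T} ->
    (forall u : 'rV_q, (u <= B)%MS -> exists l : vertex G -> 'F_2,
       (forall i, o i \in F -> u 0 i = l (s (o i)) + l (t (o i))) /\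
       {in js, forall j, l (s (o j)) + l (t (o j)) = 0}) ->
  lin_free B (map cutvec js).
Proof.
move=> /connP cF; elim: js m B => //= j js IHjs m B /andP[jjs ujs] jsT cobB.
have jT : o j \in T by apply/jsT/mem_head.
pose lj v : 'F_2 := (v \in side j)%:R.
split.
  apply/negP => /cobB[l [lF /(_ j (mem_head _ _)) lj0]].
  (* If [cutvec j] were in the span, [h] would be constant along the connected [F], yet it takes
     different values at the two ends of [o j]. *)
  pose h v := l v + lj v.
  have hF u v : h u = h v.
    have := cF u v; apply: (@connect_ind _ _ (fun v => h u = h v)) => // x y ->.
    case/linkP=> f fF xy; have: h (s f) = h (t f).
      have := lF (g f); rewrite gK cutvecE // gK => /(_ fF) lf.
      by apply: (addIr (h (t f))); rewrite F2_addrr /h /lj addrACA lf F2_addrr.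
    by case: xy => -[-> ->].
  have: h (s (o j)) + h (t (o j)) = 1.
    rewrite /h addrACA lj0 add0r /lj !inE connect0 (negPf (tree_edge_sep jT)).
    by rewrite addr0.
  by rewrite (hF _ (t (o j))) F2_addrr.
apply: IHjs => // [k kjs|u]; first by apply: jsT; rewrite inE kjs orbT.
rewrite -addsmxE => /sub_addsmxP[[v w] /= ->].
have [|l [lF ljs]] := cobB (v *m B); first exact: submxMl.
(* The coboundary of [lj] vanishes at the remaining [o k], since each of them is an edge of the tree
   without [o j]. *)
exists (fun v => l v + w 0 0 * lj v); split=> [i iF|k kjs].
  rewrite mxE (lF i iF) [w]mx11_scalar mul_scalar_mx !mxE eqxx mulr1n.
  by have := cutvecE i jT; rewrite mxE => ->; rewrite mulrDr addrACA.
rewrite addrACA ljs ?inE ?kjs ?orbT // add0r -mulrDr.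
have kT : o k \in T :\ o j.
  rewrite !inE (can_eq oK) jsT ?inE ?kjs ?orbT ?andbT //.
  by apply: contraNneq jjs => <-.
have /connect1 lk := link_edge s t kT.
have -> : lj (t (o k)) = lj (s (o k)).
  rewrite /lj !inE; congr (nat_of_bool _)%:R.
  apply/idP/idP => /connect_trans; apply => //.
  by rewrite connect_linkC.
by rewrite F2_addrr mulr0.
Qed.

Lemma kept0 F : kept 0 F = F.
Proof. by rewrite /kept (_ : low 0 = set0) ?setU0 //; apply/setP => e; rewrite !inE. Qed.

(** Every edge is processed. Either a broken circuit lies in [F] and every monomial is bad, or a
    monomial is bad exactly when it involves a variable outside [F]. *)
Lemma bc_ideal_leaf F :
  (forall h, bc_ideal 0 F h) \/
  (forall h, lin_ideal (diag_mx (\row_i (o i \notin F)%:R : 'rV['F_2]_q)) h <->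
             bc_ideal 0 F h).
Proof.
have [/existsP[C /andP[circC CF]]|/existsPn noC] :=
  boolP [exists C, circuit C && (broken o C \subset F)].
  left=> h x _; apply/orP; right; apply/existsP; exists C; rewrite circC.
  exact: subset_trans CF (subsetUl _ _).
right=> h; have := mono_ideal_vars [set i | o i \notin F] h.
have -> : \row_i (i \in [set i | o i \notin F])%:R
    = \row_i (o i \notin F)%:R :> 'rV['F_2]_q.
  by apply/rowP => i; rewrite !mxE inE.
move=> vars_h; apply: (iff_trans vars_h); apply: eq_mono_ideal => x; apply/idP/idP.
  case/exists_inP=> i; rewrite inE => iF xi; apply/orP; left.
  by apply/existsP; exists (o i); rewrite iF inE oK.
case/orP=> [/existsP[e /and3P[_ eF ex]]|/existsP[C /andP[circC CF]]].
  by apply/exists_inP; exists (g e); rewrite ?inE ?gK // inE in ex *.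
have := noC C; rewrite circC => /subsetPn[e eC eF].
have := subsetP CF e eC; rewrite !inE (negPf eF) => xe.
by apply/exists_inP; exists (g e); rewrite ?inE ?gK.
Qed.

Lemma uniq_tree_seq : uniq tree_seq.
Proof. by rewrite filter_uniq // enum_uniq. Qed.

(** Induction on [m]: a non-bridge is handled by contraction and deletion together. For a bridge the
    ideal equals that of the contraction, so connectedness is never lost. *)
Lemma regular_thetas m F : (m <= q)%N -> {in F, forall f, (m <= g f)%N} ->
  conn (kept m F) -> regular (bc_ideal m F) thetas.
Proof.
elim: m F => [|m IHm] F ltmq highF cK.
  rewrite kept0 in cK; have [full|eq_lin] := bc_ideal_leaf F.
    exact: regular_full.
  apply: regular_eq eq_lin _; rewrite /thetas (eq_map theta_lin) map_comp.
  apply: regular_lin_ideal; apply: (lin_free_cutvec cK uniq_tree_seq).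
    by move=> j; rewrite mem_filter treeP => /andP[].
  (* Combinations of the variables outside [F] have zero coordinates on [F], so the zero labelling
     serves. *)
  move=> _ /submxP[u ->]; exists (fun=> 0); split=> [i iF|j _]; last by rewrite addr0.
  by rewrite mul_mx_diag !mxE iF mulr0 addr0.
have [cKe|ncKe] := boolP (conn (kept m F)).
  apply: (@regular_colon_adjoin _ _ _ 'X_(Ordinal ltmq)).
  - exact: bc_ideal_ideal.
  - have: regular (bc_ideal m (o (Ordinal ltmq) |: F)) thetas.
      apply: IHm; rewrite ?(ltnW ltmq) ?kept_contract // => f.
      by rewrite !inE => /predU1P[->|/highF/ltnW //]; rewrite oK.
    by apply: regular_eq => h; rewrite bc_ideal_contract.
  - have: regular (bc_ideal m F) thetas.
      by apply: IHm; rewrite ?(ltnW ltmq) // => f /highF/ltnW.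
    by apply: regular_eq => h; rewrite (bc_ideal_delete ltmq).
have: regular (bc_ideal m (o (Ordinal ltmq) |: F)) thetas.
  apply: IHm; rewrite ?(ltnW ltmq) ?kept_contract // => f.
  by rewrite !inE => /predU1P[->|/highF/ltnW //]; rewrite oK.
apply: regular_eq => h; apply: eq_mono_ideal => x.
by rewrite (bad_bridge ltmq).
Qed.

(** * Deletion and contraction for the h-vector *)

Local Notation num_col := (num_col s t).
Local Notation nao := (nao s t).

(** The chromatic polynomial with h-vector [H] of a graph with [r.+1] vertices, without the constant
    term. *)
Definition hsum (H : nat -> nat) r (z : int) : int :=
  \sum_(i < r.+1) (-1) ^+ i * (H i)%:Z * z * (z - 1) ^+ (r - i).

(** Multiplication by the variable of the contracted edge raises degrees by one, hence the shift for
    the contraction. *)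
Definition hshift (H : nat -> nat) d : nat := if d is d'.+1 then H d' else 0%N.

(** All generators vanish at the origin, so the constant [1] is not in the ideal. *)
Lemma indep_leaf F : (forall C, circuit C -> ~~ (broken o C \subset F)) ->
  indep_mod (adjoins (bc_ideal 0 F) thetas) 0 1.
Proof.
move=> nbc; exists (fun=> 1); split=> [k|c]; first exact: dhomog1.
rewrite big_ord1 => Jc k; rewrite (ord1 k) {k}.
pose J (h : S) := h.@[fun=> 0] = 0.
have idJ : is_ideal J.
  rewrite /J; split=> [|h1 h2 e1 e2|a h eh]; first exact: meval0.
    by rewrite mevalD e1 e2 addr0.
  by rewrite mevalM eh mulr0.
have JX i : J 'X_i by rewrite /J mevalXU.
suff: J (c ord0 *: 1) by rewrite /J mevalZ meval1 mulr1.
apply: adjoins_min Jc => // [h|_ /mapP[j _ ->]]; last first.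
  by apply: ideal_sum => // i _; apply: JX.
apply: mono_ideal_terms => // x bad_x; have [_ _ JM] := idJ.
have [e xe] : exists e, (0 < x (g e))%N.
  case/orP: bad_x => [/existsP[e /and3P[_ _]]|/existsP[C /andP[circC]]].
    by rewrite inE; exists e.
  move=> CF; have := nbc C circC; case/subsetPn=> e eC eF.
  by exists e; have := subsetP CF e eC; rewrite !inE (negPf eF).
by rewrite (mpolyX_dvd _ xe) mulrC; apply: JM.
Qed.

Lemma hsum_split H1 H2 r z :
  hsum (fun d => H1 d + hshift H2 d)%N r.+1 z = hsum H1 r.+1 z - hsum H2 r z.
Proof.
rewrite /hsum big_ord_recl [in RHS]big_ord_recl -addrA; congr (_ + _).
  by rewrite addn0.
rewrite -sumrB; apply: eq_bigr => i _.
rewrite subSS /= /bump /= add1n PoszD exprS; ring.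
Qed.

Lemma hsum_bridge H r z : H r.+1 = 0%N -> hsum H r.+1 z = (z - 1) * hsum H r z.
Proof.
move=> Hr; rewrite /hsum big_ord_recr /= Hr mulr0 !mul0r addr0 mulr_sumr.
apply: eq_bigr => i _; have le_ir : (i <= r)%N by rewrite -ltnS ltn_ord.
rewrite subSn // exprS; ring.
Qed.

(** The condition on [num_col 2] says that [F] has [r.+1] components, that is, that the contracted
    graph has [r.+1] vertices. The condition on broken circuits records that no processed edge was a
    loop when its turn came; at [m = 0] it makes the ideal proper. *)
Lemma minor_h_vector m F r (v0 : vertex G) :
    (m <= q)%N -> {in F, forall f, (m <= g f)%N} -> conn (kept m F) ->
    (forall C, circuit C -> {in C, forall e, (m <= g e)%N} ->
       ~~ (broken o C \subset F)) ->
    num_col 2 F set0 = (2 ^ r.+1)%N ->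
  exists H : nat -> nat,
  [/\ forall n, (num_col n F (low m))%:Z = hsum H r n%:Z,
      (nao F (low m) <= \sum_(i < r.+1) H i * 2 ^ (r - i))%N,
      forall d, indep_mod (adjoins (bc_ideal m F) thetas) d (H d)
    & forall d, (r < d)%N -> H d = 0%N].
Proof.
elim: m F r => [|m IHm] F r ltmq highF cK nbc col2.
  rewrite kept0 in cK; have low0 : low 0 = set0 by apply/setP => e; rewrite !inE.
  have r0 : r = 0%N.
    move: col2; rewrite (col_conn _ v0) // expnS => /eqP.
    by rewrite -{1}[2%N]muln1 eqn_pmul2l // eq_sym; case: (r) => // r'; rewrite expnS; lia.
  exists (fun d => (d == 0)%N : nat); rewrite r0 low0; split.
  - by move=> n; rewrite (col_conn _ v0) // /hsum big_ord1 !mul1r mulr1.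
  - by rewrite big_ord1 nao_set0.
  - case=> [|d]; last exact: indep_mod0.
    by apply: indep_leaf => // C circC; apply: nbc.
  - by case.
pose i := Ordinal ltmq; pose e := o i.
have eF : e \notin F := last_notin ltmq highF.
have highFW : {in F, forall f, (m <= g f)%N} by move=> f /highF/ltnW.
have lowE : low m.+1 = e |: low m := low_succ ltmq.
have e_low : e \in low m.+1 by rewrite lowE setU11.
have [loop_e|noloop] := boolP (connect (link F) (s e) (t e)).
  (* A loop leaves no coloring and no acyclic orientation. *)
  exists (fun=> 0%N); split=> //.
  - move=> n; rewrite (col_loop _ e_low) // /hsum big1 // => k _.
    by rewrite mulr0 !mul0r.
  - by rewrite (nao_loop e_low).
  - by move=> d; apply: indep_mod0.
(* The component of [s e] in [F] misses [t e], so contracting [e] merges two components and halves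
   the number of 2-colorings. *)
have cutF : exists U, [/\ cut_free s t (F :|: set0) U, s e \in U & t e \notin U].
  exists [set v | connect (link F) (s e) v]; rewrite !inE setU0; split=> // f fF.
  have /connect1 lf := link_edge s t fF.
  rewrite !inE; apply/idP/idP => /connect_trans; apply => //.
  by rewrite connect_linkC.
have [U [cutU sU tU]] := cutF.
have col2e : num_col 2 (e |: F) set0 = (2 ^ r)%N.
  by apply/eqP; rewrite -(eqn_pmul2l (isT : 0 < 2)%N) -(col_cut _ cutU) // col2 expnS.
have highFe : {in e |: F, forall f, (m <= g f)%N}.
  by move=> f; rewrite !inE => /predU1P[->|/highFW //]; rewrite oK.
have nbc_e (F' : {set edge G}) : F' \subset e |: F ->
    forall C, circuit C -> {in C, forall f, (m <= g f)%N} -> ~~ (broken o C \subset F').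
  move=> sF' C circC highC; apply/negP => CF'.
  have [c [cC defC minC]] := brokenP circC.
  have CF : broken o C \subset e |: F := subset_trans CF' sF'.
  have eC : e \in C.
    apply: contraT => eC; have /negP[] : ~~ (broken o C \subset F).
      apply: nbc => // f fC; have := highC f fC; rewrite (leq_gE ltmq).
      by case/predU1P=> // fe; rewrite fe -/e (negPf eC) in fC.
    apply/subsetP => f fC; have := subsetP CF f fC; rewrite !inE.
    case/predU1P=> // fe; move: fC; rewrite fe defC !inE (negPf eC) andbF //.
  (* All edges of [C] have index at least [m], the index of [e], so [e] is the minimum; then
     [C :\ e] lies in [F] and [e] would be a loop. *)
  have ce : c = e.
    apply: (can_inj gK); apply: val_inj; apply/eqP.
    by rewrite /= eqn_leq minC //= oK /= highC.
  case/negP: noloop; have := circuit_connect ends_st circC eC.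
  apply: connect_link_sub; rewrite -ce -defC; apply/subsetP => f fC.
  by have := subsetP CF f fC; move: fC; rewrite defC !inE -ce => /andP[/negPf->].
have [r' def_r] : exists r', r = r'.+1.
  case: (r) col2e => [|r' _]; last by exists r'.
  by move=> col1; have := col_ge s t 2 (e |: F) v0; rewrite col1.
rewrite {}def_r {r} in col2 col2e *.
have [H2 [col_H2 nao_H2 ind_H2 big_H2]] :
  exists H : nat -> nat,
  [/\ forall n, (num_col n (e |: F) (low m))%:Z = hsum H r' n%:Z,
      (nao (e |: F) (low m) <= \sum_(i < r'.+1) H i * 2 ^ (r' - i))%N,
      forall d, indep_mod (adjoins (bc_ideal m (e |: F)) thetas) d (H d)
    & forall d, (r' < d)%N -> H d = 0%N].
  by apply: IHm; rewrite ?(ltnW ltmq) ?kept_contract //; apply: nbc_e.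
have dc n : (num_col n F (low m.+1))%:Z =
    (num_col n F (low m))%:Z - (num_col n (e |: F) (low m))%:Z.
  by rewrite (col_delete_contract s t n F (low m) e) -lowE PoszD addrK.
have ndc := nao_delete_contract s t F (last_notin_low ltmq); rewrite -lowE in ndc.
have [cKe|ncKe] := boolP (conn (kept m F)).
  have [H1 [col_H1 nao_H1 ind_H1 big_H1]] :
    exists H : nat -> nat,
    [/\ forall n, (num_col n F (low m))%:Z = hsum H r'.+1 n%:Z,
        (nao F (low m) <= \sum_(i < r'.+2) H i * 2 ^ (r'.+1 - i))%N,
        forall d, indep_mod (adjoins (bc_ideal m F) thetas) d (H d)
      & forall d, (r'.+1 < d)%N -> H d = 0%N].
    by apply: IHm; rewrite ?(ltnW ltmq) //; apply/nbc_e/subsetUr.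
  exists (fun d => H1 d + hshift H2 d)%N; split.
  - by move=> n; rewrite hsum_split -col_H1 -col_H2 dc.
  - apply: leq_trans ndc _; apply: leq_trans (leq_add nao_H1 nao_H2) _.
    rewrite big_ord_recl [leqRHS]big_ord_recl addn0 -addnA leq_add2l.
    rewrite -big_split /=; apply: leq_sum => k _.
    by rewrite subSS mulnDl.
  - case=> [|d].
      rewrite addn0; apply: indep_mod_sub (ind_H1 0) => h; apply: adjoins_mono.
      by move=> h' Ih'; apply/(bc_ideal_delete ltmq highF)/sub_adjoin.
    rewrite addnC; apply: (@indep_mod_split _ _ _ i).
    + exact: bc_ideal_ideal.
    + have: regular (bc_ideal m F) thetas by apply: regular_thetas; rewrite ?(ltnW ltmq).
      by apply: regular_eq => h; rewrite bc_ideal_delete.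
    + apply: indep_mod_sub (ind_H2 d) => h; apply: adjoins_mono => h'.
      by move/(bc_ideal_contract ltmq).
    + apply: indep_mod_sub (ind_H1 d.+1) => h; apply: adjoins_mono => h'.
      by move/(bc_ideal_delete ltmq highF).
  - by case=> // d ltrd; rewrite /= big_H1 // big_H2.
rewrite (kept_delete ltmq highF) in ncKe.
have [U' [+ sU' tU']] := bridge_cut cK ncKe.
rewrite -(kept_delete ltmq highF) => cutU2.
(* For a bridge the ideal is that of the contraction, while colorings get a factor [n - 1] and the
   bound on acyclic orientations a factor 2. *)
exists H2; split.
- move=> n; rewrite hsum_bridge ?big_H2 // -col_H2 dc.
  by rewrite (col_cut n cutU2 sU' tU') PoszM mulrBl mul1r.
- apply: leq_trans ndc _.
  have := leq_add (leq_trans (nao_cut cutU2 sU' tU') nao_H2) nao_H2.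
  move/leq_trans; apply; rewrite [leqRHS]big_ord_recr /= [H2 r'.+1]big_H2 // addn0.
  rewrite addnn -mul2n big_distrr /=; apply: leq_sum => k _.
  by rewrite subSn -1?ltnS // expnS mulnCA.
- move=> d; apply: indep_mod_sub (ind_H2 d) => h; apply: adjoins_mono => h'.
  by move=> bh x /bh; rewrite (bad_bridge ltmq) // (kept_delete ltmq highF).
- by move=> d ltrd; apply/big_H2/ltnW.
Qed.

End BrokenCircuitIdeals.

(** * Standard monomials and the h-vector *)

Section StandardMonomials.

Variables (G : multigraph) (s t : edge G -> vertex G) (o : enumeration G).
Variable g : edge G -> 'I_(nedges G).
Hypothesis ends_st : forall e, ends e = [set s e; t e].
Hypothesis st_neq : forall e, s e != t e.
Hypotheses (oK : cancel o g) (gK : cancel g o).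
Hypothesis treeT : spanning_tree (tree_edges o).

Local Notation q := (nedges G).
Local Notation T := (tree_edges o).
Local Notation S := {mpoly 'F_2[q]}.

(** The tree contains no circuit, so any circuit in [o i |: T] passes through [o i]; connectedness
    of the tree provides one. *)
Lemma fund_circuitP (i : 'I_q) : (i < nullity G)%N ->
  [/\ circuit (fund_circuit o i), o i \in fund_circuit o i
    & fund_circuit o i \subset o i |: T].
Proof.
move=> ik; have iT : o i \notin T by rewrite (treeP oK) -ltnNge.
have /connP/(_ (s (o i)) (t (o i))) := conn_tree ends_st treeT.
move=> /(circuit_of_path ends_st (st_neq (o i)) iT)[C [circC iC CT]].
rewrite /fund_circuit; case: pickP => [D /andP[circD DT]|/(_ C)]; last first.
  by rewrite circC CT.
split=> //=; have [_ acT] := treeT; apply: contraT => iD.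
have := acT D circD; case/subsetPn=> f fD fT.
have := subsetP DT f fD; rewrite !inE (negPf fT) orbF => /eqP fi.
by rewrite -fi fD in iD.
Qed.

Lemma mbroken_fund (i : 'I_q) : (i < nullity G)%N ->
  mbroken o (fund_circuit o i) = (U_(i) *+ (#|fund_circuit o i| - 1))%MM.
Proof.
move=> ik; have [circC iC CT] := fund_circuitP ik.
rewrite /mbroken; case: pickP => [j /andP[jk /eqP eqC]|/(_ i)]; last first.
  by rewrite ik eqxx.
have [_ jC _] := fund_circuitP jk.
have -> : j = i.
  have := subsetP CT (o j); rewrite eqC jC in_setU1 (treeP oK) leqNgt jk orbF.
  by move/(_ isT)/eqP/(can_inj oK).
have [c [cC -> _]] := brokenP oK gK circC.
by rewrite (cardsD1 c (fund_circuit o i)) cC addnC addnK.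
Qed.

Lemma fund_monomialE (i : 'I_q) :
  fund_monomial o i = if (i < nullity G)%N then (#|fund_circuit o i| - 2)%N else 0%N.
Proof.
rewrite /fund_monomial mnm_sumE; case: ifP => ik.
  rewrite (bigD1 i) //= mulmnE mnm1E eqxx mul1n big1 ?addn0 //.
  by move=> j /andP[_ /negPf ne_ji]; rewrite mulmnE mnm1E ne_ji.
apply: big1 => j jk; rewrite mulmnE mnm1E.
by case: eqP => // ji; rewrite -ji jk in ik.
Qed.

(** The monomial of the fundamental circuit of [o i] is a power of one variable, with exponent one
    less than the length; as it does not divide [x], the exponent in [x] is at most the length minus
    2. *)
Lemma Lset_fund_monomial x : Lset o x -> (x <= fund_monomial o)%MM.
Proof.
case/andP=> /forallP monx; rewrite negb_and => /orP[/negP[]|/existsPn nUx].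
  exact/forallP.
apply/mnm_lepP => i; rewrite fund_monomialE; case: ifPn => ik; last first.
  by have := monx i; rewrite leqNgt ik => /eqP->.
have [circC _ _] := fund_circuitP ik.
have := nUx (fund_circuit o i); rewrite circC mbroken_fund //=.
apply: contraR; rewrite -ltnNge => lt; apply/mnm_lepP => j.
by rewrite mulmnE mnm1E; case: eqP => [<-|//]; lia.
Qed.

Local Notation J := (adjoins (bc_ideal o g q set0) (thetas o)).

(** Spanning is given modulo [relations]; this carries it over to [J], modulo which independent
    families are constructed. *)
Lemma relations_sub f : f \in relations o -> J f.
Proof.
have idI : is_ideal (bc_ideal o g q set0) by apply: bc_ideal_ideal.
have idJ := adjoins_ideal (thetas o) idI; have [_ JD JM] := idJ.
case/relationsP=> a [b ->]; apply: JD; apply: ideal_sum => //.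
  move=> C circC; apply/JM/sub_adjoins.
  rewrite /xset -(big_morph (fun x => 'X_[x] : S) (@mpolyXD _ _) (@mpolyX0 _ _)).
  apply/mono_idealX/orP; right; apply/existsP; exists C; rewrite circC.
  apply/subsetP => e eC; rewrite !inE mnm_sumE (bigD1 (g e)) ?gK //=.
  by rewrite mnm1E eqxx.
move=> j jk; apply/JM/mem_adjoins => //; apply: map_f.
by rewrite mem_filter jk mem_enum.
Qed.

Lemma h_le_l_num d N : has_NBC_basis o -> indep_mod J d N -> (N <= l_num o d)%N.
Proof.
move=> [_ [_ spanL]]; apply: indep_mod_leq.
- exact/adjoins_ideal/bc_ideal_ideal.
- apply: adjoins_graded; last exact/mono_ideal_graded/bad_upward.
  by move=> _ /mapP[j _ ->]; rewrite theta_lin dhomog_lin.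
move=> f; have [r [c [allL f_span]]] := spanL (nbc_class o f).
exists (\sum_(x <- r) c x *: 'X_[x]); split.
  apply/relations_sub/nbc_classP; rewrite f_span.
  elim: (r) => [|x r' IHr]; first by rewrite !big_nil /nbc_class raddf0.
  by rewrite !big_cons nbc_classD -IHr -nbc_scaleE.
move=> x x_d; rewrite mcoeff_msupp linear_sum /= => nz_x.
have xr : x \in r.
  apply: contraNT nz_x => xr; rewrite big_seq big1 // => y yr.
  by rewrite mcoeffZ mcoeffX; case: eqP xr => [<-|]; rewrite ?yr ?mulr0.
have lt_x : (mdeg x < d.+1)%N by rewrite x_d.
exists (BMultinom lt_x) => //; rewrite inE /= x_d eqxx orbF.
by apply: Lset_fund_monomial; apply: (allP allL).
Qed.

End StandardMonomials.

(** * From the minors back to the graph *)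

Lemma int_poly_eq0 (Q : {poly int}) : (forall n : nat, Q.[n%:Z] = 0) -> Q = 0.
Proof.
move=> rootQ; apply/eqP; apply: contraT => nzQ.
have := max_poly_roots nzQ (rs := [seq n%:Z | n <- iota 0 (size Q)]).
rewrite size_map size_iota ltnn; apply.
  by apply/allP => _ /mapP[n _ ->]; rewrite rootE rootQ.
by rewrite map_inj_uniq ?iota_uniq // => a b [].
Qed.

(** Evaluation at 0 kills every term except the constant one. The other coefficients are compared in
    powers of the variable minus 1, after cancelling the common linear factor. *)
Lemma h_vector_unique (G : multigraph) P h (H : nat -> nat) p :
    nvertices G = p.+1 -> is_h_vector G P h ->
    (forall n : nat, P.[n%:Z] = hsum H p n%:Z) ->
  h p.+1 = 0 /\ forall d, (d <= p)%N -> h d = (H d)%:Z.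
Proof.
move=> Gp [defP _] PH; rewrite Gp in defP.
have hP n : P.[n%:Z] = \sum_(i < p.+1) (-1) ^+ i * h i * n%:Z * (n%:Z - 1) ^+ (p - i)
    + (-1) ^+ p.+1 * h p.+1.
  rewrite defP hornerD hornerC horner_sum; congr (_ + _); apply: eq_bigr => i _.
  rewrite hornerZ hornerM hornerX horner_exp hornerD hornerN hornerX hornerC.
  by rewrite subn1 mulrA.
have hp0 : h p.+1 = 0.
  have := hP 0; rewrite PH /hsum !big1 ?add0r => [|i _|i _]; try by rewrite mulr0 mul0r.
  by move/esym/eqP; rewrite mulf_eq0 signr_eq0 => /eqP.
(* [Q] has the differences as coefficients, in reverse order; evaluating the identity at [n.+1]
   turns it into [n.+1] times the value of [Q] at [n]. *)
split=> // d le_dp; pose Q : {poly int} :=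
  \poly_(j < p.+1) ((-1) ^+ (p - j) * (h (p - j)%N - (H (p - j)%N)%:Z)).
have /(congr1 (fun R : {poly int} => R`_(p - d))) : Q = 0.
  apply: int_poly_eq0 => n; have := hP n.+1; rewrite PH hp0 mulr0 addr0.
  rewrite /hsum => /eqP; rewrite eq_sym -subr_eq0 -sumrB => /eqP e0.
  have n1 : n.+1%:Z - 1 = n%:Z by rewrite -addn1 PoszD addrK.
  apply/eqP; have: n.+1%:Z * Q.[n%:Z] == 0.
    rewrite -{}e0 horner_poly mulr_sumr (reindex_inj rev_ord_inj) /=; apply/eqP.
    apply: eq_bigr => i _; rewrite subSS n1.
    have le_ip : (i <= p)%N by rewrite -ltnS ltn_ord.
    by rewrite subKn //; ring.
  by rewrite mulf_eq0.
rewrite coef_poly coef0 ltnS leq_subr subKn // => /eqP.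
by rewrite mulf_eq0 signr_eq0 subr_eq0 => /eqP.
Qed.

(** An orientation is determined by the set [X w] of edges directed from [s] to [t]. *)
Lemma num_acyclic_orientations_le (G : multigraph) (s t : edge G -> vertex G) :
    (forall e, ends e = [set s e; t e]) ->
  (num_acyclic_orientations G <= nao s t set0 setT)%N.
Proof.
move=> ends_st; pose X (w : {ffun edge G -> vertex G * vertex G}) :=
  [set e | w e == (s e, t e)].
have oriX w : orientation w -> forall e, oriented s t (X w) e = w e.
  move=> /forallP ori_w e; have /eqP := ori_w e.
  rewrite ends_st /oriented inE => /eq_set2; case: eqP => [-> //|ne].
  by case=> uv; [case: ne|]; rewrite -uv -surjective_pairing.
have X_inj : {in [set w | orientation w && acyclic w] &, injective X}.
  move=> w w'; rewrite !inE => /andP[ow _] /andP[ow' _] eqX.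
  by apply/ffunP => e; rewrite -oriX // eqX oriX.
rewrite /num_acyclic_orientations -(card_in_imset X_inj).
apply: subset_leq_card; apply/subsetP => _ /imsetP[w + ->].
rewrite !inE => /andP[ow /forallP acw]; rewrite subsetT /=.
apply/forall_inP => e _; rewrite oriX //; apply: contra (acw e).
apply: connect_sub => u v /stepP[/linkP[f]|[f _]]; first by rewrite inE.
by rewrite oriX // => wf; apply/connect1/existsP; exists f; rewrite wf.
Qed.

Lemma loopless_ends (G : multigraph) : loopless G ->
  exists s t : edge G -> vertex G,
    (forall e, ends e = [set s e; t e]) /\ forall e, s e != t e.
Proof.
move=> noloop; have /fin_all_exists[p pP] e : exists p : vertex G * vertex G,
    ends e = [set p.1; p.2] /\ p.1 != p.2.
  by have /eqP/cards2P[u [v [ne_uv ->]]] := noloop e; exists (u, v).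
by exists (fun e => (p e).1), (fun e => (p e).2); split=> e; have [] := pP e.
Qed.

Theorem theorem5p2 (G : multigraph) (o : enumeration G)
    (P : {poly int}) (h : nat -> int) :
  connected_graph G -> loopless G ->
  standard_ordering o -> has_NBC_basis o ->
  is_chromatic_poly G P -> is_h_vector G P h ->
  (forall d : nat, h d <= (l_num o d)%:Z)
  /\ (num_acyclic_orientations G
      <= \sum_(d < nvertices G) l_num o d * 2 ^ (nvertices G - d - 1))%N.
Proof.
move=> [p_gt0 cG] /loopless_ends[s [t [ends_st st_neq]]].
move=> [[g oK gK] _ treeT] NBC chrP hP.
have /card_gt0P[v0 _] := p_gt0.
have [p Gp] : exists p, nvertices G = p.+1 by exists (nvertices G).-1; rewrite prednK.
have lowT : low g (nedges G) = setT by apply/setP => e; rewrite !inE ltn_ord.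
(* The induction is applied to the whole graph: nothing is processed or contracted, and there are
   [p.+1] one-vertex components. *)
have [||||H [col_H nao_H ind_H big_H]] :=
  @minor_h_vector G s t o g ends_st st_neq oK gK treeT (nedges G) set0 p v0 (leqnn _).
- by move=> f; rewrite inE.
- by apply/connP => u v; rewrite /kept set0U lowT -(connect_adj ends_st).
(* An empty broken circuit would make its remaining edge a loop. *)
- move=> C circC _; have [c [cC -> _]] := brokenP oK gK circC; apply/negP => C0.
  have st0 := connect_link_sub C0 (circuit_connect ends_st circC cC).
  suff st : s c = t c by have := st_neq c; rewrite -st eqxx.
  by apply: (connect_ind _ _ st0) => // u v _ /linkP[f]; rewrite inE.
- by rewrite col_set0 -/(nvertices G) Gp.
rewrite lowT in col_H nao_H.
have H_le d : (H d <= l_num o d)%N.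
  by apply: (h_le_l_num ends_st st_neq oK gK treeT) (ind_H d).
have PH n : P.[n%:Z] = hsum H p n%:Z.
  rewrite chrP -col_H; congr _%:Z; apply: eq_card => f; rewrite [LHS]inE.
  apply/forallP/coloringsP => [prop_f|[_ cf] e].
    split=> e; rewrite inE // => _.
    by have /forallP/(_ (s e))/forallP/(_ (t e)) := prop_f e; rewrite ends_st eqxx.
  apply/forallP => u; apply/forallP => v; apply/implyP; rewrite ends_st => /eqP/eq_set2.
  by case=> -[-> ->]; [|rewrite eq_sym]; apply: cf; rewrite inE.
have [hp0 h_H] := h_vector_unique Gp hP PH.
split=> [d|].
  (* Beyond [p], the value at [p.+1] vanishes by comparison of constant terms, and the later ones by
     definition of the h-vector. *)
  have [le_dp|lt_pd] := leqP d p; first by rewrite h_H // lez_nat.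
  suff -> : h d = 0 by [].
  case: (ltngtP p.+1 d) lt_pd => // [lt_pd|<-] _ //.
  by case: hP => _; apply; rewrite Gp.
apply: leq_trans (num_acyclic_orientations_le ends_st) _.
apply: leq_trans nao_H _; rewrite Gp; apply: leq_sum => d _.
by rewrite subnAC subn1 leq_mul.
Qed.
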